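(* Let $m,n\ge1$. Every pseudo-energy is a positive Laurent polynomial in the entries $z'_{j,i}$ ($1\le j\le n$, $j\le i\le m$) of the $Q$-pattern of $\mathbf{x}=(x_i^j)$. In particular, the $Q$-invariants $Q_i^{(j)}$ and the reduced $Q$-invariants $\widetilde{Q}_i^{(j)}$ ($i\in[m]$, $j\in[n]$, $i+j\le m$) are positive Laurent polynomials in the $z'_{j,i}$.
   Context: A positive Laurent polynomial is one with positive integer coefficients (on the monomials that occur; the zero polynomial is allowed). $[k]=\{1,\dots,k\}$. The $x_i^j$ ($i\in[m],j\in[n]$) are independent indeterminates over $\mathbb{C}$; for $r\in\mathbb{Z}$, $x_i^{(r)}=x_i^j$ where $j\in[n]$, $j\equiv r-i+1\pmod n$. $Q$-pattern: for $y=(y_1,\dots,y_n)$, $W(y)$ is the $n\times n$ matrix with diagonal $y$, $1$'s in positions $(a+1,a)$, zeros elsewhere; $M(\mathbf{x}_1,\dots,\mathbf{x}_i)=W(\mathbf{x}_1)\cdots W(\mathbf{x}_i)$ with $\mathbf{x}_a=(x_a^1,\dots,x_a^n)$. With $\Delta_I(A)$ the minor with rows $I$ and columns $1,\dots,|I|$ ($\Delta_\emptyset=1$), $$z'_{j,i}=\frac{\Delta_{[j,n]}(M(\mathbf{x}_1,\dots,\mathbf{x}_i))}{\Delta_{[j+1,n]}(M(\mathbf{x}_1,\dots,\mathbf{x}_i))},\qquad 1\le j\le n,\ j\le i\le m.$$ Loop skew Schur function: $s^{(r)}_{\lambda/\mu}=\sum_T\prod_{s\in\lambda/\mu}x_{T(s)}^{(c(s)+r)}$,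 over semistandard Young tableaux of shape $\lambda/\mu$ (English notation) with entries in $[m]$; a cell $s$ in row $a$, column $b$ has $c(s)=a-b$; equals $1$ if $\lambda=\mu$. In the colored skew shape $\rho^{(r)}$, cell $s$ has color $c(s)+r$ mod $n$. A NW corner of $\rho$ is a cell $(a,b)\in\rho$ with $(a-1,b),(a,b-1)\notin\rho$; a SE corner is a cell $(a,b)\in\rho$ with $(a+1,b),(a,b+1)\notin\rho$. $\rho^{(r)}$ satisfies the corner color condition if all NW corners have color $n$ and all SE corners have color $m$ (mod $n$). A pseudo-energy is a loop skew Schur function $s_\rho^{(r)}$ such that $\rho^{(r)}$ satisfies the corner color condition. Shape invariants: $S_k=s^{(n)}_{((n-k+1)^{m-k+1})}$ for $1\le k\le p:=\min(m,n)$, $S_{p+1}=1$. For $i+j\le m$ let $0\le K\le n-1$, $K\equiv i+j-m-1\pmod n$, $\lambda_i^j=((n-j+K+1)^{m-n+K},(n-j)^{m-i-j})$, $\mu_i^j=((n-j+1)^{m-n+K-i})$ (exponents are multiplicities); $Q_i^{(j)}=s^{(n-j+1)}_{\lambda_i^j/\mu_i^j}$ and $\widetilde{Q}_i^{(j)}=Q_i^{(j)}/(S_{j+1}S_{n+1-K})$. *)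

(* Defs.v *)
From HB Require Import structures.
From mathcomp Require Import all_boot all_order all_algebra.
From mathcomp Require Import fraction mpoly.

Set Implicit Arguments.
Unset Strict Implicit.
Unset Printing Implicit Defensive.
Import Order.TTheory GRing.Theory Num.Theory.
Local Open Scope ring_scope.

(* The field of rational functions over C in the m * n indeterminates x_i^j,
   indexed through the bijection mxvec_index. *)
Definition ratfun (C : fieldType) (m n : nat) : fieldType :=
  {fraction {mpoly C[m * n]}}.

Definition generic_matrix (C : fieldType) (m n : nat) : 'M[ratfun C m n]_(m, n) :=
  \matrix_(i < m, j < n) tofrac ('X_(mxvec_index i j) : {mpoly C[m * n]}).

(* E is the set of exponent vectors that occur, c e > 0 the coefficient of the
   monomial of exponent e; E = [::] gives the zero Laurent polynomial. *)
Definition positive_laurent (F : fieldType) (I : finType) (z : I -> F) (f : F)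
    : Prop :=
  exists (E : seq {ffun I -> int}) (c : {ffun I -> int} -> nat),
    [/\ uniq E, {in E, forall e, (0 < c e)%N}
      & f = \sum_(e <- E) (c e)%:R * \prod_(k : I) z k ^ e k].

(* Partitions are weakly decreasing sequences, trailing zeros being allowed.
   Cells are pairs (a, b) of a row and a column, numbered from 1; the part of
   index a is the item a.-1 of the sequence. *)
Definition is_partition (la : seq nat) : bool := sorted geq la.

Definition skew_shape (la mu : seq nat) : Prop :=
  [/\ is_partition la, is_partition mu
    & forall a : nat, (nth 0 mu a <= nth 0 la a)%N].

Definition in_skew (la mu : seq nat) (a b : nat) : bool :=
  ((0 < a) && (nth 0 mu a.-1 < b <= nth 0 la a.-1))%N.

Definition NW_corner (la mu : seq nat) (a b : nat) : bool :=
  [&& in_skew la mu a b, ~~ in_skew la mu a.-1 b & ~~ in_skew la mu a b.-1].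

Definition SE_corner (la mu : seq nat) (a b : nat) : bool :=
  [&& in_skew la mu a b, ~~ in_skew la mu a.+1 b & ~~ in_skew la mu a b.+1].

Definition content (a b : nat) : int := a%:Z - b%:Z.

Definition corner_color_condition (m n : nat) (la mu : seq nat) (r : int)
    : Prop :=
  (forall a b : nat, NW_corner la mu a b ->
     (content a b + r = n%:Z %[mod n%:Z])%Z) /\
  (forall a b : nat, SE_corner la mu a b ->
     (content a b + r = m%:Z %[mod n%:Z])%Z).

(* The two bounds only serve to make the type of cells finite. *)
Definition cell (la mu : seq nat) : finType :=
  {p : 'I_(size la).+1 * 'I_(head 0%N la).+1 | in_skew la mu p.1 p.2}.

Definition cell_row (la mu : seq nat) (s : cell la mu) : nat := (val s).1.
Definition cell_col (la mu : seq nat) (s : cell la mu) : nat := (val s).2.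

(* The entry k : 'I_m of a tableau stands for k.+1 in [m]. *)
Definition semistandard (m : nat) (la mu : seq nat)
    (T : {ffun cell la mu -> 'I_m}) : bool :=
  [forall s : cell la mu, forall t : cell la mu,
     ((cell_row s == cell_row t) && (cell_col s < cell_col t)%N
        ==> (T s <= T t)%N) &&
     ((cell_col s == cell_col t) && (cell_row s < cell_row t)%N
        ==> (T s < T t)%N)].

(* \Delta_I(A); enum_val enumerates I in increasing order. *)
Lemma card_set_ord_leq (n : nat) (I : {set 'I_n}) : (#|I| <= n)%N.
Proof. by rewrite -[X in (_ <= X)%N]card_ord max_card. Qed.

Definition left_minor (F : fieldType) (n : nat) (I : {set 'I_n})
    (A : 'M[F]_n) : F :=
  \det (mxsub (fun k : 'I_#|I| => enum_val k)
              (fun k : 'I_#|I| => widen_ord (card_set_ord_leq I) k) A).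

Definition W (F : fieldType) (n : nat) (y : 'rV[F]_n) : 'M[F]_n :=
  diag_mx y + \matrix_(a < n, b < n) (a == b.+1 :> nat)%:R.

Definition Z_index (m n : nat) : finType :=
  {p : 'I_n * 'I_m | (p.1 <= p.2)%N}.

(* X i j is x_{i+1}^{j+1}. *)
Section LoopSymmetric.
Variables (F : fieldType) (m n : nat) (X : 'M[F]_(m, n)).

(* W(x_1) ... W(x_i), the factors being in increasing order of k. *)
Definition Mprod (i : nat) : 'M[F]_n :=
  \big[mulmx/1%:M]_(k < m | (k < i)%N) W (row k X).

(* z'_{j,i}, with j and i numbered from 1. *)
Definition z' (j i : nat) : F :=
  left_minor [set k : 'I_n | (j <= k.+1)%N] (Mprod i) /
  left_minor [set k : 'I_n | (j.+1 <= k.+1)%N] (Mprod i).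

Definition Q_pattern (k : Z_index m n) : F :=
  z' (val k).1.+1 (val k).2.+1.

(* x_{i+1}^{(r)}; exactly one j satisfies the congruence when 0 < n. *)
Definition loop_var (i : 'I_m) (r : int) : F :=
  if [pick j : 'I_n | (j.+1%:Z == r - i.+1%:Z + 1 %[mod n%:Z])%Z] is Some j
  then X i j else 0.

(* s^{(r)}_{la/mu} *)
Definition loop_schur (la mu : seq nat) (r : int) : F :=
  \sum_(T : {ffun cell la mu -> 'I_m} | semistandard T)
    \prod_(s : cell la mu)
      loop_var (T s) (content (cell_row s) (cell_col s) + r).

Definition pseudo_energy (f : F) : Prop :=
  exists (la mu : seq nat) (r : int),
    [/\ skew_shape la mu, corner_color_condition m n la mu r
      & f = loop_schur la mu r].

Definition shape_inv (k : nat) : F :=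
  if (k <= minn m n)%N
  then loop_schur (nseq (m - k + 1) (n - k + 1)%N) [::] n%:Z
  else 1.

Definition Q_K (i j : nat) : nat :=
  `|((i%:Z + j%:Z - m%:Z - 1) %% n%:Z)%Z|%N.

(* For i in [m], j in [n], i + j <= m, none of the subtractions below is
   truncated. *)
Definition Q_la (i j : nat) : seq nat :=
  nseq (m + Q_K i j - n) (n - j + Q_K i j + 1)%N ++ nseq (m - (i + j)) (n - j)%N.

Definition Q_mu (i j : nat) : seq nat :=
  nseq (m + Q_K i j - n - i) (n - j + 1)%N.

Definition Q_inv (i j : nat) : F :=
  loop_schur (Q_la i j) (Q_mu i j) (n%:Z - j%:Z + 1).

Definition reduced_Q_inv (i j : nat) : F :=
  Q_inv i j / (shape_inv j.+1 * shape_inv (n + 1 - Q_K i j)).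

End LoopSymmetric.

(* Main.v *)
Require Import Defs.
From HB Require Import structures.
From mathcomp Require Import all_boot all_order all_algebra perm.
From mathcomp Require Import fraction mpoly complex reals zify.

Set Implicit Arguments.
Unset Strict Implicit.
Unset Printing Implicit Defensive.
Import Order.TTheory GRing.Theory Num.Theory.
Local Open Scope ring_scope.

(* A tableau is a family of non-intersecting paths: the column b is a particle
   that starts at position mu'_b - b + r and at step i either stays in place, with
   weight x_i^j where j is its position mod n, if i occurs in the column, or moves
   down by one.  So a loop skew Schur function is a minor of the n-periodic infinite
   matrix that unfolds W(x_1) ... W(x_m).  The corner color condition says that in
   every block of n consecutive positions the rows of the minor form a final
   segment and its columns an initial one.  Hence the minor does not change when
   W(x_i) is replaced by u_(i-1) W(x_i) u_i^(-1), with u_i upper unitriangular.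
   One can choose the u_i so that the new factors are sparse: apart from entries 1
   below the diagonal, the i-th one has the diagonal entries z'_(j,i) / z'_(j,i-1)
   for j < i and, if i <= n, the entry (-1)^(n-i) z'_(i,i) in its first row.  In the
   expansion of the minor, a path that uses the latter entry jumps over exactly
   n - i other paths, which absorbs the sign: all terms are Laurent monomials in
   the z' with coefficient 1.  The shape invariant S_k is the product of the
   z'_(j,m) with j >= k, which settles the reduced Q-invariants. *)

(** * Unfolding n x n matrices to n-periodic infinite matrices *)

(** An upper unitriangular [u] can be moved through the unfolded matrix because its first column and
    its last row are basis vectors, so it fixes the only entry linking two consecutive blocks. It
    also preserves the bottom-left minors of a product, and [z'] is a quotient of two consecutive
    such minors; so these quotients survive the change of factors and reappear as quotients of
    pivots in an LU decomposition. The obstacle is that all the [u_i] are determined by [u_0], which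
    must be chosen beforehand so that each later factor still starts with enough zeros in its first
    row. Row [a] of [u_0] only has to clear entries in the product of the first [a + 1] factors, so
    its rows can be chosen independently. The signs cancel because two quantities shrink together:
    the length of the jump allowed by a factor, and the part of each block where the rows of the
    minor must still form a run. The divisions require nonzero corner minors. The indeterminates
    enter only there; the rest holds over any field for any matrix with these minors nonzero. *)

Section LoopAction.
Variables (F : fieldType) (n' k : nat).
Local Notation n := n'.+1.
Implicit Types (A B u : 'M[F]_n) (V : nat -> 'rV[F]_k) (f g : 'I_k -> nat).

(* The position q stands for row q %% n of block q %/ n.  An infinite matrix
   acts on families V of row vectors, the rows of the remaining factors:
   blockact A has the diagonal blocks A, and loopact A has moreover an entry 1
   from row 0 of each block to the last row of the previous block. *)
Definition blockact A V (q : nat) : 'rV[F]_k :=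
  \sum_(c < n) A (inord (q %% n)) c *: V (q %/ n * n + c)%N.

Definition pred_row V (q : nat) : 'rV[F]_k := if q is p.+1 then V p else 0.

Definition loopact A V (q : nat) : 'rV[F]_k :=
  blockact A V q + (q %% n == 0)%N%:R *: pred_row V q.

Definition unitri u := forall a b : 'I_n, (b <= a)%N -> u a b = (a == b)%:R.

Definition rdet V f : F := \det (\matrix_(a < k) V (f a)).

Lemma eq_blockact A V V' : V =1 V' -> blockact A V =1 blockact A V'.
Proof. by move=> eV q; apply: eq_bigr => c _; rewrite eV. Qed.

Lemma eq_loopact A V V' : V =1 V' -> loopact A V =1 loopact A V'.
Proof.
by move=> eV q; rewrite /loopact (eq_blockact _ eV); case: q => //= q; rewrite eV.
Qed.

Lemma eq_rdet V V' f : V =1 V' -> rdet V f = rdet V' f.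
Proof. by move=> eV; congr (\det _); apply/matrixP=> a b; rewrite !mxE eV. Qed.

Lemma divn_block (q : nat) (c : 'I_n) : ((q * n + c) %/ n = q)%N.
Proof. by rewrite divnMDl // divn_small // addn0. Qed.

Lemma modn_block (q : nat) (c : 'I_n) : ((q * n + c) %% n = c)%N.
Proof. by rewrite modnMDl modn_small. Qed.

Lemma blockact_mul A B V : blockact (A *m B) V =1 blockact A (blockact B V).
Proof.
move=> q; rewrite /blockact.
under eq_bigr do rewrite mxE scaler_suml.
rewrite exchange_big; apply: eq_bigr => c _; rewrite scaler_sumr.
apply: eq_bigr => d _.
by rewrite divn_block modn_block inord_val scalerA.
Qed.

Lemma inord_mod (q : nat) : (inord (q %% n) : 'I_n) = (q %% n)%N :> nat.
Proof. by rewrite inordK // ltn_mod. Qed.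

(** The predecessor of the first position of a block is the last position of the block before, and
    the last row of [u] is a basis vector. *)
Lemma unitri_blockact_pred u V q : unitri u -> (q %% n == 0)%N ->
  pred_row (blockact u V) q = pred_row V q.
Proof.
case: q => // q uu; rewrite -/(dvdn _ _) => /= /dvdnP[s Eq].
have -> : q = (s.-1 * n + n')%N by case: s Eq => [|s]; rewrite ?mul0n // mulSn /=; lia.
have -> : n' = (ord_max : 'I_n) by [].
rewrite /blockact divn_block modn_block inord_val (bigD1 ord_max) //=.
rewrite uu // eqxx scale1r big1 ?addr0 // => c Hc.
have Hu : u ord_max c = 0 by rewrite uu; [rewrite eq_sym (negPf Hc) | exact: (ltn_ord c)].
by rewrite Hu scale0r.
Qed.

Lemma loopact_mulr A u V : unitri u ->
  loopact (A *m u) V =1 loopact A (blockact u V).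
Proof.
move=> uu q; rewrite /loopact blockact_mul; congr (_ + _).
by case: eqP => [/eqP H|_]; rewrite ?scale0r // unitri_blockact_pred.
Qed.

(** The linking entry sits in row 0 of each block, and column 0 of [u] is a basis vector. *)
Lemma loopact_mull u A V : unitri u ->
  blockact u (loopact A V) =1 loopact (u *m A) V.
Proof.
move=> uu q; rewrite /loopact blockact_mul -/(blockact A V).
rewrite {1}/blockact; under eq_bigr do rewrite scalerDr.
rewrite big_split /=; congr (_ + _).
rewrite (bigD1 ord0) //= big1 ?addr0; last first.
  move=> c Hc; rewrite modn_block; have -> : (c == 0 :> nat) = false.
    by apply: contraNF Hc => /eqP H; apply/eqP/val_inj.
  by rewrite scale0r scaler0.
rewrite uu // modnMDl addn0 mod0n eqxx scale1r.
rewrite -val_eqE /= inord_mod; case: eqP => [H|_]; last by rewrite !scale0r.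
by have := divn_eq q n; rewrite H addn0 => <-.
Qed.

(** The last hypothesis says that the chosen rows form a final segment of each block. Row [f a] of
    the new family then combines only chosen rows of its own block, through a triangular matrix [T]
    with unit diagonal. *)
Lemma rdet_blockact_l u V f : unitri u ->
  {homo f : a b / (a < b)%N >-> (b < a)%N} ->
  (forall a, ((f a %% n).+1 < n)%N -> exists b, f b = (f a).+1) ->
  rdet (blockact u V) f = rdet V f.
Proof.
move=> uu fdec fup.
have finj : injective f.
  move=> a b E; apply/val_inj; case: (ltngtP a b) => // /fdec; lia.
have fup' a d : (f a %% n + d < n)%N -> exists b, f b = (f a + d)%N.
  elim: d => [|d IH] H; first by exists a; rewrite addn0.
  have [|b Hb] := IH; first by lia.
  have E : (f b %% n = f a %% n + d)%N.
    by rewrite Hb {1}(divn_eq (f a) n) -addnA modnMDl modn_small //; lia.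
  by have [|b' Hb'] := fup b; [lia | exists b'; rewrite Hb'; lia].
pose T := \matrix_(a < k, b < k)
   ((f a %/ n == f b %/ n)%N%:R * u (inord (f a %% n)) (inord (f b %% n))).
have detT : \det T = 1.
  rewrite det_trig; last first.
    apply/is_trig_mxP => a b ab; rewrite mxE; case: eqP => E; rewrite ?mul0r //.
    have lt : (f b %% n < f a %% n)%N.
      by have := fdec _ _ ab; rewrite {1}(divn_eq (f a) n) E {1}(divn_eq (f b) n) ltn_add2l.
    rewrite mul1r uu; last by rewrite !inord_mod ltnW.
    by rewrite -val_eqE /= !inord_mod gtn_eqF.
  by rewrite big1 // => a _; rewrite mxE eqxx uu // eqxx mul1r.
rewrite -[RHS]mul1r -detT -det_mulmx; congr (\det _).
apply/row_matrixP=> a; rewrite row_mul !rowK mulmx_sum_row.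
rewrite /blockact.
transitivity (\sum_(c < n) \sum_(b < k | f b == (f a %/ n * n + c)%N)
   u (inord (f a %% n)) c *: V (f b)).
  apply: eq_bigr => c _.
  have [lec|ltc] := leqP (f a %% n) c; last first.
    rewrite uu ?inord_mod 1?ltnW // -val_eqE /= inord_mod gtn_eqF // scale0r big1 //.
    by move=> b _; rewrite scale0r.
  have [|b Hb] := fup' a (c - f a %% n)%N; first by have := ltn_ord c; lia.
  have Hb' : f b = (f a %/ n * n + c)%N by rewrite Hb {1}(divn_eq (f a) n); lia.
  rewrite (big_pred1 b) ?Hb' // => b'; rewrite -Hb' /=.
  by apply/eqP/eqP => [/finj|->].
rewrite (exchange_big_dep xpredT) //=; apply: eq_bigr => b _.
rewrite rowK [X in _ = X *: _]mxE [X in _ = X *: _]mxE.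
case: (eqVneq (f a %/ n)%N (f b %/ n)%N) => [E|E]; last first.
  rewrite mul0r scale0r big1 // => c /eqP Hc; case/eqP: E.
  by rewrite Hc divn_block.
rewrite mul1r (big_pred1 (inord (f b %% n))) // => c /=.
rewrite {1}(divn_eq (f b) n) E eqn_add2l -val_eqE /= inord_mod.
by rewrite eq_sym.
Qed.

Definition base_row g (q : nat) : 'rV[F]_k := \row_b (q == g b)%N%:R.

(** Dual statement for columns: a column of [u] reaches only smaller indices of its block, and these
    are all chosen, so [u] acts on the chosen columns by a matrix of determinant 1. *)
Lemma blockact_base_unitri u g : unitri u ->
  {homo g : a b / (a < b)%N >-> (b < a)%N} ->
  (forall a, (0 < g a %% n)%N -> exists b, (g b).+1 = g a) ->
  exists2 T : 'M[F]_k, \det T = 1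
    & forall q, blockact u (base_row g) q = base_row g q *m T.
Proof.
move=> uu gdec gdown.
have ginj : injective g.
  move=> a b E; apply/val_inj; case: (ltngtP a b) => // /gdec; lia.
have gdown' a d : (d <= g a %% n)%N -> exists b, (g b + d)%N = g a.
  elim: d => [|d IH] H; first by exists a; rewrite addn0.
  have [|b Hb] := IH; first by lia.
  have E : (g a %% n = g b %% n + d)%N.
    have E1 := divn_eq (g b) n; have E2 : (g b %% n + d < n \/ n <= g b %% n + d)%N by lia.
    case: E2 => E2; first by rewrite -Hb {1}E1 -addnA modnMDl modn_small.
    have /esym := modnMDl (g b %/ n) (g b %% n + d) n; rewrite addnA -E1 Hb.
    have : (g a %% n < n)%N by rewrite ltn_mod.
    have : (g b %% n < n)%N by rewrite ltn_mod.
    move=> L1 L2; have -> : (g b %% n + d = (g b %% n + d - n) + n)%N by lia.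
    by rewrite modnDr modn_small; lia.
  by have [|b' Hb'] := gdown b; [lia | exists b'; lia].
pose T := \matrix_(a < k, b < k)
   ((g a %/ n == g b %/ n)%N%:R * u (inord (g a %% n)) (inord (g b %% n))).
have detT : \det T = 1.
  rewrite det_trig; last first.
    apply/is_trig_mxP => a b ab; rewrite mxE; case: eqP => E; rewrite ?mul0r //.
    have lt : (g b %% n < g a %% n)%N.
      by have := gdec _ _ ab; rewrite {1}(divn_eq (g a) n) E {1}(divn_eq (g b) n) ltn_add2l.
    rewrite mul1r uu; last by rewrite !inord_mod ltnW.
    by rewrite -val_eqE /= !inord_mod gtn_eqF.
  by rewrite big1 // => a _; rewrite mxE eqxx uu // eqxx mul1r.
exists T => // q; apply/rowP => b; rewrite /blockact summxE mxE.
transitivity ((q %/ n == g b %/ n)%N%:R * u (inord (q %% n)) (inord (g b %% n))).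
  case: eqP => E; last first.
    rewrite mul0r big1 // => c _; rewrite !mxE; case: eqP => H; rewrite ?mulr0 //.
    by case: E; rewrite -H divn_block.
  rewrite mul1r (bigD1 (inord (g b %% n))) //= big1 => [|c Hc]; rewrite !mxE.
    by rewrite inord_mod E -divn_eq eqxx mulr1 addr0.
  rewrite E {2}(divn_eq (g b) n) eqn_add2l.
  case: eqP => H; rewrite ?mulr0 //; case/eqP: Hc; apply/val_inj.
  by rewrite /= inord_mod.
case: (pickP (fun a => q == g a)) => [a /eqP Hq|Hq].
  rewrite (bigD1 a) //= big1 => [|a' Ha']; rewrite !mxE.
    by rewrite Hq eqxx mul1r addr0.
  by rewrite Hq (inj_eq ginj) eq_sym (negPf Ha') mul0r.
rewrite [RHS]big1 => [|a _]; last by rewrite mxE Hq mul0r.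
case: eqP => E; rewrite ?mul0r // mul1r.
case: (leqP (q %% n) (g b %% n)) => H.
  have [|a Ha] := gdown' b (g b %% n - q %% n)%N; first by lia.
  have /eqP[] := Hq a; have := divn_eq (g b) n; have := divn_eq q n; rewrite E; lia.
rewrite uu; last by rewrite !inord_mod ltnW.
by rewrite -val_eqE /= !inord_mod gtn_eqF.
Qed.

Lemma rdet_mulmx V T f : rdet (fun q => V q *m T) f = rdet V f * \det T.
Proof.
rewrite -det_mulmx; congr (\det _); apply/row_matrixP => a.
by rewrite row_mul !rowK.
Qed.

Lemma blockact_mulmx A V T q : blockact A (fun q => V q *m T) q = blockact A V q *m T.
Proof. by rewrite mulmx_suml; apply: eq_bigr => c _; rewrite -scalemxAl. Qed.

End LoopAction.

(** * Minors of a product with one sparse factor *)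

Section RowLists.
Variables (F : fieldType) (k : nat).
Implicit Types (l : seq 'rV[F]_k) (v : 'rV[F]_k).

(** Rows form a list so that replacing, inserting and moving a row are list operations. *)
Definition ldet l : F := \det (\matrix_(a < k) nth 0 l a).

Lemma ldet_lin l1 l2 v w x : size (l1 ++ v :: l2) = k ->
  ldet (l1 ++ (v + x *: w) :: l2) = ldet (l1 ++ v :: l2) + x * ldet (l1 ++ w :: l2).
Proof.
rewrite size_cat /= => sz.
have lt1 : (size l1 < k)%N by lia.
rewrite -[ldet (l1 ++ v :: l2)]mul1r.
have row'E z z' : row' (Ordinal lt1) (\matrix_(a < k) nth 0 (l1 ++ z :: l2) a)
                = row' (Ordinal lt1) (\matrix_(a < k) nth 0 (l1 ++ z' :: l2) a).
  apply/matrixP=> a b; rewrite !mxE !nth_cat; case: ltnP => // le.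
  case E: (_ - _)%N => //=.
  by case/eqP: (neq_lift (Ordinal lt1) a); apply/val_inj => /=; move: E le => /=; lia.
apply: (determinant_multilinear (i0 := Ordinal lt1)); [|exact: row'E..].
by rewrite !rowK !nth_cat ltnn subnn /= scale1r.
Qed.

Lemma ldet_dup l a b : (a < b < k)%N -> nth 0 l a = nth 0 l b -> ldet l = 0.
Proof.
move=> /andP[ab bk] E; have ak := ltn_trans ab bk.
apply: (@determinant_alternate _ _ _ (Ordinal ak) (Ordinal bk)).
  by rewrite -val_eqE /= ltn_eqF.
by move=> c; rewrite !mxE E.
Qed.

Lemma ldet_zero l1 l2 : size (l1 ++ 0 :: l2) = k -> ldet (l1 ++ 0 :: l2) = 0.
Proof.
move=> sz; have := ldet_lin 0 1 sz.
by rewrite scaler0 addr0 mul1r -[LHS]addr0 => /addrI <-.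
Qed.

Lemma ldet_swap l1 l2 v w : size (l1 ++ v :: w :: l2) = k ->
  ldet (l1 ++ v :: w :: l2) = - ldet (l1 ++ w :: v :: l2).
Proof.
move=> sz; have lt2 : ((size l1).+1 < k)%N by move: sz; rewrite size_cat /=; lia.
have dup u l : ldet (l1 ++ u :: u :: l) = 0.
  apply: (@ldet_dup _ (size l1) (size l1).+1); first by lia.
  by rewrite !nth_cat ltnn subnn ltnNge leqnSn /= subSnn.
have sz1 u1 u2 : size (l1 ++ u1 :: u2 :: l2) = k by move: sz; rewrite !size_cat.
have sz2 u1 u2 : size (rcons l1 u1 ++ u2 :: l2) = k.
  by rewrite cat_rcons sz1.
have := dup (v + 1 *: w) l2.
rewrite ldet_lin // -!(cat_rcons _ l1) !ldet_lin // !cat_rcons !mul1r !dup // addr0 add0r.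
by move/eqP; rewrite addr_eq0 => /eqP.
Qed.

Lemma ldet_cycle l1 l2 l3 v : size (l1 ++ l2 ++ v :: l3) = k ->
  ldet (l1 ++ l2 ++ v :: l3) = (-1) ^+ size l2 * ldet (l1 ++ v :: l2 ++ l3).
Proof.
elim: l2 l1 => [|w l2 IH] l1 /= sz; first by rewrite mul1r.
rewrite -cat_rcons IH ?cat_rcons // ldet_swap ?mulrN ?exprS ?mulN1r ?mulNr //.
by move: sz; rewrite !size_cat /= !size_cat /=; lia.
Qed.

End RowLists.

(** * Positivity of minors through one sparse factor *)

Section Step.
Variables (F : fieldType) (n' k : nat).
Local Notation n := n'.+1.

(* The sign of the entry (0, d) is that of the cycle that brings a row moved
   from 0 to d past the rows moved from 1, ..., d to 0, ..., d - 1. *)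
Definition Nmat (d : nat) (h : nat -> F) : 'M[F]_n :=
  \matrix_(a, b) ((a == b.+1 :> nat)%:R + (-1) ^+ d * h d *+ ((a == 0 :> nat) && (b == d :> nat))
     + h a / h a.-1 *+ ((a == b) && (d < a)%N)).

(** The subdiagonal entries and the linking entry merge into one uniform move to the predecessor,
    across block boundaries too. *)
Lemma loopact_Nmat d h (V : nat -> 'rV[F]_k) q : (d < n)%N ->
  loopact (Nmat d h) V q = pred_row V q
    + ((-1) ^+ d * h d *+ (q %% n == 0)%N) *: V (q + d)%N
    + (h (q %% n)%N / h (q %% n).-1 *+ (d < q %% n)%N) *: V q.
Proof.
move=> dn; rewrite /loopact /blockact.
under eq_bigr do rewrite mxE !scalerDl.
rewrite !big_split /= !inord_mod.
rewrite [LHS]addrAC; congr (_ + _); last first.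
  rewrite (bigD1 (inord (q %% n))) //= big1 => [|c Hc]; last first.
    by rewrite eq_sym (negPf Hc) scale0r.
  by rewrite eqxx /= addr0 inord_mod -divn_eq.
rewrite [LHS]addrAC; congr (_ + _); last first.
  rewrite (bigD1 (inord d)) //= big1 => [|c Hc]; last first.
    have -> : (c == d :> nat) = false.
      by apply: contraNF Hc => /eqP <-; rewrite inord_val.
    by rewrite andbF scale0r.
  rewrite addr0 inordK // eqxx andbT.
  case: eqP => E; last by rewrite !scale0r.
  by have := divn_eq q n; rewrite E addn0 => <-.
case: (altP eqP) => [E|E].
  rewrite big1 => [|c _]; first by rewrite add0r scale1r.
  by rewrite E scale0r.
rewrite scale0r addr0.
have lt : (q %% n < n)%N by rewrite ltn_mod.
have lt1 : ((q %% n).-1 < n)%N by lia.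
rewrite (bigD1 (Ordinal lt1)) //= big1 => [|c Hc]; last first.
  have -> : (q %% n == c.+1)%N = false.
    by apply: contraNF Hc => /eqP H; apply/eqP/val_inj; rewrite /= H.
  by rewrite scale0r.
rewrite prednK ?lt0n // eqxx scale1r addr0.
have -> : (q %/ n * n + (q %% n).-1 = q.-1)%N.
  by move: E (divn_eq q n); move: (q %/ n * n)%N (q %% n)%N => x y; lia.
by case: q E {lt lt1} => [|q] //; rewrite mod0n.
Qed.
(** For [d = n'] this is the final segment condition in each block. Each sparse factor weakens it by
    one, until [d = 0] imposes nothing. *)
Definition upclosed (d : nat) (K : seq nat) :=
  forall q, q \in K -> (q %% n < d)%N -> q.+1 \in K.

Section Positivity.
Variables (P : F -> Prop) (d : nat) (h : nat -> F) (V : nat -> 'rV[F]_k).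
Hypotheses (P0 : P 0) (PD : forall x y, P x -> P y -> P (x + y))
  (PM : forall x y, P x -> P y -> P (x * y)).
Hypotheses (dn : (d < n)%N) (Ph : P (h d))
  (Pr : forall c, (d < c < n)%N -> P (h c / h c.-1)).
Hypothesis PV : forall K, sorted gtn K -> size K = k -> upclosed d.-1 K ->
  P (ldet (map V K)).

Let NV := loopact (Nmat d h) V.

Lemma modn_succ q : (q.+1 %% n)%N = if (q %% n == n')%N then 0%N else (q %% n).+1.
Proof.
have lt : (q %% n < n)%N by rewrite ltn_mod.
rewrite -addn1 -modnDml addn1; case: eqP => [->|/eqP H]; first by rewrite modnn.
by rewrite modn_small //; lia.
Qed.

Lemma sorted_gtn_cat (s1 s2 : seq nat) : sorted gtn s1 -> sorted gtn s2 ->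
  (forall p q, p \in s1 -> q \in s2 -> (q < p)%N) -> sorted gtn (s1 ++ s2).
Proof.
have tr : transitive gtn by move=> x y z /= H1 H2; apply: ltn_trans H2 H1.
rewrite !(sorted_pairwise tr) pairwise_cat => -> -> H; rewrite !andbT.
by apply/allrelP => p q; apply: H.
Qed.

(* K lists the rows of NV that remain to be expanded, from the largest position
   down, and Q the rows of V chosen so far. *)
Lemma ldet_step_aux K Q : sorted gtn Q -> upclosed d.-1 Q -> sorted gtn K ->
  (forall p q, p \in Q -> q \in K -> (q <= p)%N) ->
  (forall q, q \in K -> (q %% n < d)%N -> (q.+1 \in K) || (q \in Q)) ->
  (size Q + size K = k)%N -> P (ldet (map V Q ++ map NV K)).
Proof.
elim: K Q => [|q K IH] Q sQ uQ sK QK cl sz.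
  by rewrite cats0; apply: PV => //; rewrite -sz addn0.
have tr : transitive gtn by move=> x y z /= H1 H2; apply: ltn_trans H2 H1.
have sK' : sorted gtn K by move: sK; apply: path_sorted.
have ltK q' : q' \in K -> (q' < q)%N.
  by move: sK; rewrite /= (path_sortedE tr) => /andP[/allP H _] /H.
have QK' p q' : p \in Q -> q' \in q :: K -> (q' <= p)%N by exact: QK.
have nqK : q.+1 \in q :: K = false.
  rewrite inE gtn_eqF //=; apply/negP => /ltK; lia.
have ltn : (q %% n < n)%N by rewrite ltn_mod.
have szc v : size (map V Q ++ v :: map NV K) = k.
  by rewrite size_cat /= !size_map.
rewrite /= {1}/NV loopact_Nmat // !ldet_lin //.
(* Common end of the moves to [q.-1] and to [q]. Hypothesis [cl] persists: if [q'] has residue below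
   [d] and [q'.+1 = q], then [q] has residue between 1 and [d], so it can neither stay nor jump and
   must move to [q']. *)
have add (p : nat) : sorted gtn (rcons Q p) -> upclosed d.-1 (rcons Q p) ->
   (q <= p.+1)%N -> (forall q', q' \in K -> (q' %% n < d)%N -> q'.+1 = q -> q' = p) ->
   P (ldet (map V Q ++ V p :: map NV K)).
  move=> sQp uQp qp Hq'; rewrite -cat_rcons -map_rcons; apply: IH => //.
  - move=> p' q'; rewrite mem_rcons inE => /orP[/eqP-> /ltK|H1 H2]; first by lia.
    by apply: QK'; rewrite // inE H2 orbT.
  - move=> q' Hq lt; have := cl q'; rewrite !inE Hq orbT => /(_ isT lt).
    rewrite mem_rcons inE => /orP[/orP[/eqP H|->]|->]; rewrite ?orbT //.
    by rewrite (Hq' _ Hq lt H) eqxx orbT.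
  - by rewrite size_rcons -sz /=; lia.
apply: PD; first apply: PD.
- case: q {IH QK} sK ltK QK' nqK ltn szc add sz cl => [|q] /= sK ltK QK' nqK ltn szc add sz cl.
    by rewrite ldet_zero.
  apply: add => //; last by move=> q' _ _ [].
    rewrite -cats1; apply: sorted_gtn_cat => // p r pQ; rewrite inE => /eqP->.
    by apply: QK'; rewrite ?mem_head.
  move=> r; rewrite !mem_rcons !inE => /orP[/eqP->|rQ] lt; last by rewrite uQ ?orbT.
  have lt' : (q.+1 %% n < d)%N by rewrite modn_succ; case: eqP; lia.
  by have := cl q.+1 (mem_head _ _) lt'; rewrite nqK /= => ->; rewrite orbT.
- case: eqP => E; last by rewrite mulr0n mul0r.
  (* At residue 0, [cl] puts [q] itself in [Q] when [d > 0], since [q.+1] is no longer pending;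
     [upclosed d.-1] then adds its successors up to [q + d - 1]. *)
  have mem t : (t < d)%N -> (q + t)%N \in Q.
    elim: t => [|t IHt] lt; rewrite ?addn0 ?addnS.
      by have := cl q (mem_head _ _); rewrite nqK /= E; apply.
    apply: uQ; first by apply: IHt; lia.
    by rewrite -modnDml E add0n modn_small; lia.
  have [inQ|ninQ] := boolP ((q + d)%N \in Q).
    rewrite (@ldet_dup _ _ _ (index (q + d)%N Q) (size Q)) ?mulr0 //.
      by rewrite -sz index_mem inQ /=; lia.
    rewrite !nth_cat size_map index_mem inQ ltnn subnn /= (nth_map 0%N) ?index_mem //.
    by rewrite nth_index.
  pose Q1 := [seq p <- Q | (q + d < p)%N]; pose Q2 := [seq p <- Q | (p < q + d)%N].
  have EQ : Q = Q1 ++ Q2.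
    apply: (sorted_eq tr) => //.
    + by move=> x y /andP[/= H1 H2]; lia.
    + apply: sorted_gtn_cat; rewrite ?(sorted_filter tr) //.
      by move=> p r; rewrite !mem_filter => /andP[H1 _] /andP[H2 _]; lia.
    + rewrite -(perm_filterC (fun p => (q + d < p)%N) Q) perm_cat2l.
      rewrite (@eq_in_filter _ _ (fun p => (p < q + d)%N)) // => p pQ /=.
      rewrite -leqNgt leq_eqVlt; case: eqP => //= pE.
      by case/negP: ninQ; rewrite -pE.
  (* Nothing in [Q] is below [q], so [Q2] is exactly [q, ..., q + d - 1]. The jumping row passes [d]
     rows, and the sign of this cycle cancels the sign of the entry. *)
  have szQ2 : size Q2 = d.
    rewrite -(size_iota q d); apply/perm_size/uniq_perm; rewrite ?iota_uniq //.
      by apply/filter_uniq/(sorted_uniq tr) => // x; rewrite /= ltnn.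
    move=> p; rewrite mem_filter mem_iota; case: (ltnP p (q + d)) => lt; rewrite ?andbF //=.
    rewrite andbT; apply/idP/idP => [pQ|le]; first by apply: QK'; rewrite ?mem_head.
    by have -> : p = (q + (p - q))%N by [lia]; apply: mem; lia.
  rewrite EQ map_cat -catA ldet_cycle; last first.
    by rewrite catA -map_cat -EQ szc.
  rewrite size_map szQ2 mulr1n mulrACA -expr2 sqrr_sign mul1r.
  apply: PM => //; pose Q' := Q1 ++ (q + d)%N :: Q2.
  have memQ' p : (p \in Q') = (p == (q + d)%N) || (p \in Q).
    by rewrite EQ !mem_cat inE orbCA.
  rewrite -cat_cons -map_cons catA -map_cat -/Q'; apply: IH => //.
  + rewrite /Q' -cat_rcons; apply: sorted_gtn_cat; rewrite ?(sorted_filter tr) //.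
      rewrite -cats1; apply: sorted_gtn_cat; rewrite ?(sorted_filter tr) //.
      by move=> p r; rewrite mem_filter inE => /andP[lt _] /eqP->.
    move=> p r; rewrite mem_rcons inE !mem_filter => H1 /andP[H2 _].
    by apply: leq_trans H2 _; case/orP: H1 => [/eqP->|/andP[/ltnW]].
  + move=> r; rewrite !memQ' => /orP[/eqP->|rQ] lt; last by rewrite uQ ?orbT.
    by move: lt; rewrite -modnDml E add0n modn_small; lia.
  + move=> p r; rewrite memQ' => /orP[/eqP-> /ltK|pQ rK]; first by lia.
    by apply: QK'; rewrite // inE rK orbT.
  + move=> r rK lt; have := cl r; rewrite !inE rK orbT memQ' => /(_ isT lt).
    case/orP=> [/orP[/eqP Eq|->]|->]; rewrite ?orbT //.
    move: E; rewrite -Eq modn_succ; case: eqP => // H _.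
    by move: lt; rewrite H ltnNge -ltnS dn.
  + by move: sz; rewrite EQ /Q' !size_cat /=; lia.
- case: ltnP => dlt; last by rewrite mulr0n mul0r.
  rewrite mulr1n; apply: PM; first by apply: Pr; rewrite dlt.
  have [inQ|ninQ] := boolP (q \in Q).
    rewrite (@ldet_dup _ _ _ (index q Q) (size Q)) //.
      by rewrite -sz index_mem inQ /=; lia.
    rewrite !nth_cat size_map index_mem inQ ltnn subnn /= (nth_map 0%N) ?index_mem //.
    by rewrite nth_index.
  apply: add => //.
  + rewrite -cats1; apply: sorted_gtn_cat => // p r pQ; rewrite inE => /eqP->.
    rewrite ltn_neqAle QK' ?mem_head // andbT.
    by apply: contraNN ninQ => /eqP->.
  + by move=> r; rewrite !mem_rcons !inE => /orP[/eqP->|rQ] lt; [lia|rewrite uQ ?orbT].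
  + by move=> q' _ lt Eq; move: dlt; rewrite -Eq modn_succ; case: eqP; lia.
Qed.

Lemma ldet_step K : sorted gtn K -> size K = k -> upclosed d K ->
  P (ldet (map NV K)).
Proof.
move=> sK sz uK; apply: (@ldet_step_aux K [::]) => // q Hq lt.
by rewrite uK.
Qed.

End Positivity.

End Step.

(** * Gaussian elimination of unit Hessenberg matrices *)

Section HessenbergLU.
Variables (F : fieldType) (n' : nat) (H : 'M[F]_n'.+1).
Local Notation n := n'.+1.
Hypothesis hessH : forall a b : 'I_n, (b < a)%N -> H a b = (a == b.+1 :> nat)%:R.

(* Division-free elimination: the entry b of lu_row c is the minor of H with
   rows 0, ..., c and columns 0, ..., c - 1, b (lemma lu_row_det). *)
Fixpoint lu_row (c : nat) : 'rV[F]_n :=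
  if c is c'.+1 then lu_row c' 0 (inord c') *: row (inord c) H - lu_row c'
  else row 0 H.

Definition lu_pivot (c : nat) : F := lu_row c 0 (inord c).

Definition lead_minor (c : nat) : F :=
  \det (\matrix_(a < c, b < c) H (inord a) (inord b)).

Lemma lu_row_lower c (b : 'I_n) : (c < n)%N -> (b < c)%N -> lu_row c 0 b = 0.
Proof.
elim: c => // c IH cn; rewrite ltnS leq_eqVlt => /orP[/eqP E|lt].
  rewrite /= !mxE hessH ?inordK ?E ?eqxx // mulr1 -E inord_val subrr //.
rewrite /= !mxE IH // ?subr0; last by lia.
rewrite hessH inordK //; last by lia.
by rewrite eqSS gtn_eqF ?mulr0.
Qed.

(** Expansion along the last row: by the Hessenberg shape only its last two entries can be nonzero,
    the first of them being 1, and the two cofactors give the two terms of the recursion of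
    [lu_row]. *)
Lemma lu_row_det c (b0 : nat) : (c < n)%N ->
  \det (\matrix_(a < c.+1, b < c.+1) H (inord a) (inord (if (b < c)%N then b : nat else b0)))
  = lu_row c 0 (inord b0).
Proof.
elim: c b0 => [|c IH] b0 cn.
  rewrite det_mx11 !mxE /=; congr (H _ _).
  by apply/val_inj; rewrite /= inordK.
rewrite (expand_det_row _ ord_max) big_ord_recr big_ord_recr /= big1 => [|b _]; last first.
  rewrite mxE /= ltnW ?ltnS // hessH; last by rewrite !inordK //; have := ltn_ord b; lia.
  rewrite !inordK //; last by have := ltn_ord b; lia.
  by rewrite eqSS gtn_eqF ?mul0r.
rewrite add0r !mxE /= ltnn ltnSn hessH !inordK //; try lia.
rewrite eqxx mul1r addrC -/lu_row; congr (_ + _).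
  rewrite mulrC; congr (_ * _); rewrite /cofactor -signr_odd addnn odd_double mul1r.
  rewrite -IH; last by lia.
  congr (\det _); apply/matrixP => a b; rewrite !mxE; congr (H (inord _) (inord _)).
    by rewrite /= /bump leqNgt ltn_ord.
  have -> : lift ord_max b = b :> nat by rewrite /= /bump leqNgt ltn_ord.
  by rewrite ltn_ord; case: ltnP => // le; apply/eqP; rewrite eqn_leq le -ltnS (ltn_ord b).
rewrite /cofactor /= addSn addnn -signr_odd /= odd_double mulN1r; congr (- _).
rewrite -IH; last by lia.
congr (\det _); apply/matrixP => a b; rewrite !mxE; congr (H (inord _) (inord _)).
  by rewrite /= /bump leqNgt ltn_ord.
have := ltn_ord b; case: (ltnP b c) => lt lt'; rewrite /= /bump.
  by rewrite [(c <= b)%N]leqNgt lt add0n ltnS ltnW.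
by have -> : (b = c :> nat) by [lia]; rewrite leqnn add1n ltnn.
Qed.

Lemma lead_minorE c : (c < n)%N -> lead_minor c.+1 = lu_pivot c.
Proof.
move=> cn; rewrite /lu_pivot -lu_row_det //; congr (\det _); apply/matrixP => a b.
rewrite !mxE; congr (H _ (inord _)); case: ltnP => //.
by have := ltn_ord b; lia.
Qed.

Variable d : nat.
Hypotheses (dn : (d < n)%N) (H0 : forall b : 'I_n, (b < d)%N -> H 0 b = 0).
Hypothesis pivot_neq0 : forall c, (d <= c < n)%N -> lead_minor c.+1 != 0.

Lemma hessenberg_LU : exists2 u, unitri u & H = Nmat n' d (lead_minor \o succn) *m u.
Proof.
(* The first [d] pivots vanish, so up to row [d] the recursion only changes the sign: this is the
   origin of [(-1) ^+ d]. *)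
have lu0 c : (c <= d)%N -> lu_row c = (-1) ^+ c *: row 0 H.
  elim: c => [|c IH] cd; first by rewrite scale1r.
  rewrite /= IH 1?ltnW // !mxE H0 ?inordK //; try lia.
  by rewrite mulr0 scale0r add0r exprS mulN1r scaleNr.
have hE c : (d <= c < n)%N -> lu_pivot c != 0.
  by move=> /[dup] /andP[_ cn] /pivot_neq0; rewrite lead_minorE.
(* Row 0 of [H] has no pivot before column [d], so rows 1 to [d], already in echelon form, come
   first and row 0 is inserted at place [d]. From there on, the eliminated rows are divided by their
   pivots. *)
exists (\matrix_(c < n) if (c < d)%N then row (inord c.+1) H
                        else (lu_pivot c)^-1 *: lu_row c).
  move=> c b bc; rewrite mxE; case: ltnP => cd.
    by rewrite mxE hessH inordK ?eqSS //; lia.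
  rewrite mxE; have := bc; rewrite leq_eqVlt => /orP[/eqP/val_inj ->|lt].
    rewrite eqxx /lu_pivot inord_val mulVf //.
    by have := hE c; rewrite /lu_pivot inord_val ltn_ord andbT; apply.
  by rewrite lu_row_lower ?ltn_ord // mulr0 -val_eqE /= gtn_eqF.
apply/row_matrixP => a; rewrite row_mul mulmx_sum_row.
have rE : forall c : 'I_n, row a (Nmat n' d (lead_minor \o succn)) 0 c =
  (a == c.+1 :> nat)%:R + (-1) ^+ d * lu_pivot d *+ ((a == 0 :> nat) && (c == d :> nat))
     + lu_pivot a / lu_pivot a.-1 *+ ((a == c) && (d < a)%N).
  move=> c; rewrite !mxE /= lead_minorE //; congr (_ + _).
  case: andP => [[_ lt]|_]; last by rewrite !mulr0n.
  by rewrite !mulr1n !lead_minorE ?ltn_ord //; have := ltn_ord a; lia.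
under eq_bigr do rewrite rE !scalerDl rowK.
rewrite !big_split /=.
set S1 := \sum_(i < n) _; set S2 := \sum_(i < n) _; set S3 := \sum_(i < n) _.
have ES1 : S1 = if a == 0 :> nat then 0 else
   if (a <= d)%N then row a H else (lu_pivot a.-1)^-1 *: lu_row a.-1.
  rewrite /S1; case: (eqVneq (a : nat) 0%N) => E.
    by rewrite big1 // => c _; rewrite E scale0r.
  have lt : (a.-1 < n)%N by have := ltn_ord a; lia.
  rewrite (bigD1 (Ordinal lt)) //= big1 => [|c Hc].
    have -> : a.-1.+1 = a by lia.
    by rewrite eqxx scale1r addr0 inord_val; congr (if _ then _ else _); lia.
  case: eqP => E'; last by rewrite scale0r.
  by case/eqP: Hc; apply/val_inj; rewrite /= E'.
have ES2 : S2 = if a == 0 :> nat then row 0 H else 0.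
  rewrite /S2; case: (eqVneq (a : nat) 0%N) => E; last first.
    by rewrite big1 // => c _; rewrite scale0r.
  rewrite (bigD1 (Ordinal dn)) //= big1 => [|c Hc].
    rewrite eqxx ltnn addr0 mulr1n lu0 // !scalerA mulfK ?hE ?leqnn ?dn //.
    by rewrite -expr2 sqrr_sign scale1r.
  case: eqP => E'; last by rewrite scale0r.
  by case/eqP: Hc; apply/val_inj.
have ES3 : S3 = if (d < a)%N then (lu_pivot a.-1)^-1 *: lu_row a else 0.
  rewrite /S3; case: ltnP => lt; last first.
    by rewrite big1 // => c _; rewrite andbF scale0r.
  rewrite (bigD1 a) //= big1 => [|c Hc]; last by rewrite eq_sym (negPf Hc) scale0r.
  rewrite eqxx addr0 ltnNge (ltnW lt) /= mulr1n scalerA mulrAC divff ?mul1r //.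
  by rewrite hE // ltn_ord ltnW.
rewrite ES1 ES2 ES3; case: (eqVneq (a : nat) 0%N) => E.
  by rewrite E ltn0 add0r addr0; congr (row _ H); apply/val_inj.
rewrite addr0; case: ltnP => lt; last by rewrite addr0.
case Ea: (a : nat) E lt => [|c] // _ dc /=.
rewrite -scalerDr addrC subrK scalerA mulVf ?scale1r; first by rewrite -Ea inord_val.
by apply: hE; rewrite -ltnS dc -Ea ltnW.
Qed.

End HessenbergLU.

(** * Sparse representatives of the factors W(x_i) *)

Section CornerMinors.
Variables (F : fieldType) (n' : nat).
Local Notation n := n'.+1.
Implicit Types (A P H u : 'M[F]_n).

Lemma det_rev s (G : nat -> nat -> F) :
  \det (\matrix_(a < s, b < s) G (s.-1 - a)%N (s.-1 - b)%N) =
  \det (\matrix_(a < s, b < s) G a b).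
Proof.
pose r := perm (@rev_ord_inj s).
have -> : \matrix_(a < s, b < s) G (s.-1 - a)%N (s.-1 - b)%N =
          row_perm r (col_perm r (\matrix_(a < s, b < s) G a b)).
  apply/matrixP => a b; rewrite !mxE !permE /=.
  by rewrite -!subn1 -!subnDA !add1n.
rewrite row_permE col_permE !det_mulmx !det_perm odd_permV mulrC -mulrA -signr_addb.
by rewrite addbb mulr1.
Qed.

(* The last s rows and the first s columns, both in decreasing order. *)
Definition corner_minor s A : F :=
  \det (\matrix_(a < s, b < s) A (inord (n' - a)) (inord (s.-1 - b))).

Lemma blockact_base_row k A (g : 'I_k -> nat) q : (q < n)%N ->
  (forall b, (g b < n)%N) ->
  blockact A (base_row F g) q = \row_b A (inord q) (inord (g b)).
Proof.
move=> qn gn; rewrite /blockact modn_small // divn_small // mul0n.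
apply/rowP => b; rewrite summxE mxE (bigD1 (inord (g b))) //= big1 => [|c Hc].
  by rewrite !mxE add0n inordK // eqxx mulr1 addr0.
rewrite !mxE add0n; case: eqP => E; rewrite ?mulr0 //.
by case/eqP: Hc; apply/val_inj; rewrite /= -E inord_val.
Qed.

Lemma corner_minorE s A : (s <= n)%N -> corner_minor s A =
  rdet (blockact A (base_row F (fun b : 'I_s => s.-1 - b)%N)) (fun a : 'I_s => n' - a)%N.
Proof.
move=> sn; congr (\det _); apply/matrixP => a b; rewrite !mxE.
rewrite blockact_base_row ?mxE //; first by lia.
by move=> c; have := ltn_ord c; lia.
Qed.

(** Inside block 0 the last [s] rows form a final segment and the first [s] columns an initial one,
    so both invariance lemmas apply. *)
Lemma corner_minor_unitri s u u' A : (s <= n)%N -> unitri u -> unitri u' ->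
  corner_minor s (u *m A *m u') = corner_minor s A.
Proof.
move=> sn uu uu'; rewrite !corner_minorE //.
rewrite -mulmxA (eq_rdet _ (blockact_mul _ _ _)).
rewrite rdet_blockact_l //; first last.
- move=> a; rewrite modn_small => [H|]; last by lia.
  have lt : (a.-1 < s)%N by have := ltn_ord a; lia.
  by exists (Ordinal lt) => /=; have := ltn_ord a; lia.
- by move=> a b ab; have := ltn_ord b; lia.
rewrite (eq_rdet _ (blockact_mul _ _ _)).
have [| |T detT ET] := @blockact_base_unitri _ _ _ _ (fun b : 'I_s => s.-1 - b)%N uu'.
- by move=> a b ab; have := ltn_ord b; lia.
- move=> a lt; have Ha : (s.-1 - a < n)%N by have := ltn_ord a; lia.
  rewrite modn_small // in lt; have lt' : (a.+1 < s)%N by lia.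
  by exists (Ordinal lt') => /=; lia.
by rewrite (eq_rdet _ (eq_blockact _ ET)) (eq_rdet _ (blockact_mulmx _ _ _)) rdet_mulmx detT mulr1.
Qed.

(** The last [s] rows of [P] live in the first [s] columns, so the Cauchy-Binet sum has a single
    term. *)
Lemma corner_minor_mul s P H : (s <= n)%N ->
  (forall a (c : 'I_n), (a < s)%N -> (s <= c)%N -> P (inord (n' - a)) c = 0) ->
  corner_minor s (P *m H) = corner_minor s P * lead_minor H s.
Proof.
move=> sn PE; rewrite /lead_minor -(det_rev s (fun a b => H (inord a) (inord b))) -det_mulmx; congr (\det _).
apply/matrixP => a b; rewrite !mxE.
pose G c := P (inord (n' - a)) (inord c) * H (inord c) (inord (s.-1 - b)).
transitivity (\sum_(c < n) G c).
  by apply: eq_bigr => c _; rewrite /G inord_val.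
rewrite -(big_mkord xpredT G) (big_cat_nat (n := s)) //= [X in _ + X]big_nat [X in _ + X]big1 ?addr0.
  rewrite big_mkord (reindex_inj rev_ord_inj); apply: eq_bigr => c _.
  by rewrite !mxE /G /= -!subn1 -!subnDA !add1n.
move=> c /andP[sc cn]; rewrite /G PE ?mul0r //.
by rewrite inordK.
Qed.

Variables (w : nat -> 'rV[F]_n).

Fixpoint wprod (i : nat) : 'M[F]_n :=
  if i is i'.+1 then wprod i' *m W (w i') else 1%:M.

Lemma W_E (y : 'rV[F]_n) a b : W y a b = y 0 b *+ (a == b) + (a == b.+1 :> nat)%:R.
Proof.
by rewrite !mxE; case: eqP => // ->.
Qed.

Lemma W_lower (y : 'rV[F]_n) (a b : 'I_n) : (b < a)%N -> W y a b = (a == b.+1 :> nat)%:R.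
Proof. by move=> ba; rewrite W_E -val_eqE /= gtn_eqF // mulr0n add0r. Qed.

Lemma wprod_band i (p q : 'I_n) : (p + i <= q)%N -> wprod i q p = (q == p + i :> nat)%N%:R.
Proof.
elim: i p q => [|i IH] p q le; first by rewrite mxE addn0.
have lt : (p.+1 < n)%N by have := ltn_ord q; lia.
rewrite mxE (bigD1 (Ordinal lt)) //= IH /=; last by lia.
rewrite W_lower //= eqxx mulr1 addSnnS big1 ?addr0 // => c Hc.
rewrite W_E; case: (eqVneq c p) => [->|Hcp].
  have -> : wprod i q p = 0 by rewrite IH; [rewrite gtn_eqF //|]; lia.
  by rewrite mul0r.
rewrite mulr0n add0r; case: eqP => E; rewrite ?mulr0 //.
by case/eqP: Hc; apply/val_inj.
Qed.

(** Row [t + s] of [A] has entry 1 in column [t] and zeros to its left, so subtracting a multiple of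
    it clears column [t] without spoiling the earlier ones. As [a < s], the coordinates of [v] up to
    [a] are never touched. *)
Lemma band_elimination (A : 'M[F]_n) (a s : nat) : (a < s)%N ->
  (forall p q : 'I_n, (p + s <= q)%N -> A q p = (q == p + s :> nat)%N%:R) ->
  forall t, exists v : 'rV[F]_n, (forall c : 'I_n, (c <= a)%N -> v 0 c = (c == a :> nat)%:R)
    /\ forall p : 'I_n, (p < t)%N -> (p + s < n)%N -> (v *m A) 0 p = 0.
Proof.
move=> lt bandA; elim=> [|t [v [v1 v2]]].
  by exists (\row_c (c == a :> nat)%:R); split=> // c _; rewrite mxE.
case: (ltnP (t + s) n) => ts; last first.
  exists v; split=> // p pt ps; apply: v2 => //; lia.
have tn : (t < n)%N by lia.
exists (v - (v *m A) 0 (Ordinal tn) *: delta_mx 0 (Ordinal ts)); split=> [c ca|p].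
  rewrite !mxE v1 // [(c == Ordinal ts)%B](_ : _ = false) ?andbF ?mulr0 ?subr0 //.
  by rewrite -val_eqE /=; lia.
rewrite ltnS leq_eqVlt => pt ps.
rewrite mulmxBl -scalemxAl -rowE mxE [X in _ + X]mxE [X in _ - X]mxE [X in _ - _ * X]mxE.
case/orP: pt => [/eqP pt|pt]; rewrite bandA /= ?pt //; try lia.
  by rewrite eqxx mulr1 (_ : p = Ordinal tn) ?subrr //; apply/val_inj.
by rewrite v2 // gtn_eqF ?mulr0 ?subr0 // ltn_add2r.
Qed.

(** Row [a] is tested against the product of [a.+1] factors, a different product for each row. It
    later becomes row 0 of the matrix to be decomposed at step [a]. *)
Lemma triangularizing_unitri : exists2 u, unitri u &
  forall (a c : 'I_n), (c + a < n')%N -> (u *m wprod a.+1) a c = 0.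
Proof.
have ex (a : 'I_n) : exists v : 'rV[F]_n, (forall c : 'I_n, (c <= a)%N -> v 0 c = (c == a)%:R)
    /\ forall p : 'I_n, (p + a < n')%N -> (v *m wprod a.+1) 0 p = 0.
  have [v [v1 v2]] := band_elimination (ltnSn a) (@wprod_band a.+1) n.
  by exists v; split=> // p pa; apply: v2; rewrite // addnS.
have [v Hv] := fin_all_exists ex.
exists (\matrix_a v a) => [a b ba|a c ca].
  by rewrite mxE (Hv a).1 // eq_sym.
by have := (Hv a).2 c ca; rewrite -{1}(rowK v a) -row_mul mxE.
Qed.

Section Whirls.
Variable m : nat.
Hypothesis corner_neq0 : forall i s, (i <= m)%N -> (s <= n)%N -> (n <= i + s)%N ->
  corner_minor s (wprod i) != 0.

Definition corner_ratio (i c : nat) : F :=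
  corner_minor c.+1 (wprod i.+1) / corner_minor c.+1 (wprod i).

Definition sparse_factor i := Nmat n' (n' - i) (corner_ratio i).

Fixpoint sparse_prod (i : nat) : 'M[F]_n :=
  if i is i'.+1 then sparse_prod i' *m sparse_factor i' else 1%:M.

(* Invariant: in the product of the first i sparse factors, row j >= i is the
   basis vector j - i, and row j < i vanishes right of the antidiagonal. *)
Lemma sparse_prod_low i (j c : 'I_n) : (i <= j)%N ->
  sparse_prod i j c = (j == c + i :> nat)%N%:R.
Proof.
elim: i j c => [|i IH] j c ij; first by rewrite mxE addn0.
have lt : (j - i < n)%N by have := ltn_ord j; lia.
rewrite mxE (bigD1 (Ordinal lt)) //= IH ?(ltnW ij) //= subnK ?(ltnW ij) // eqxx mul1r.
rewrite big1 ?addr0 => [|b Hb].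
  rewrite mxE /= [(j - i == 0)%N](_ : _ = false) ?mulr0n ?addr0 //; last by lia.
  rewrite [(n' - i < j - i)%N](_ : _ = false) ?andbF ?mulr0n ?addr0; last by have := ltn_ord j; lia.
  by congr (_ %:R); lia.
rewrite IH 1?ltnW //; case: eqP => E; last by rewrite mul0r.
by case/eqP: Hb; apply/val_inj => /=; lia.
Qed.

(** Row [i] is the basis vector 0 just before factor [i], whose first row sends it to column
    [n' - i], on the antidiagonal. Later factors move entries to the right only from column 0, and
    to columns left of [n' - j]. *)
Lemma sparse_prod_anti i (j c : 'I_n) : (j < i)%N -> (n' < j + c)%N ->
  sparse_prod i j c = 0.
Proof.
elim: i j c => // i IH j c; rewrite ltnS leq_eqVlt => /orP[/eqP ji|ji] jc.
  rewrite mxE (bigD1 ord0) //= big1 => [|b Hb].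
    rewrite mxE /= (_ : (c == n' - i :> nat)%N = false) ?mulr0n; last by have := ltn_ord j; lia.
    by rewrite andbF mulr0n !addr0 mulr0.
  rewrite sparse_prod_low ?ji // -[X in X == _]add0n eqn_add2r.
  rewrite eq_sym (_ : (b == 0 :> nat)%N = false) ?mul0r //.
  by apply: contraNF Hb => /eqP H; apply/eqP/val_inj.
rewrite mxE big1 // => b _; case: (ltnP n' (j + b)) => jb; first by rewrite IH ?mul0r.
rewrite mxE (_ : (b == c.+1 :> nat) = false); last by lia.
rewrite (_ : (c == n' - i :> nat)%N = false) ?andbF; last by have := ltn_ord c; lia.
rewrite (_ : (b == c) = false) ?mulr0n ?addr0 ?mulr0 //.
by rewrite -val_eqE /=; lia.
Qed.

Lemma eq_Nmat d (h h' : nat -> F) : (d < n)%N -> (forall c, (d <= c < n)%N -> h c = h' c) ->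
  Nmat n' d h = Nmat n' d h'.
Proof.
move=> dn hh; apply/matrixP => a b; rewrite !mxE hh ?leqnn ?dn //.
case: (ltnP d a) => lt; rewrite ?andbF //; have := ltn_ord a => an.
by rewrite !hh //; lia.
Qed.

Lemma whirl_factorization : exists2 us : nat -> 'M[F]_n,
  forall i, (i <= m)%N -> unitri (us i) &
  forall i, (i < m)%N -> us i *m W (w i) = sparse_factor i *m us i.+1.
Proof.
have [u0 uu0 u0E] := triangularizing_unitri.
(* u_0 fixes all the u_i: (u_0 M_i) = (N_1 ... N_i) u_i, and u_(i+1) comes from
   the LU decomposition of H = u_i W(w i), whose leading minors are quotients of
   corner minors of M_(i+1) and M_i. *)
suff H : forall k, (k <= m)%N -> exists us : nat -> 'M[F]_n,
  [/\ us 0%N = u0, (forall i, (i <= k)%N -> unitri (us i)) &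
  (forall i, (i < k)%N -> us i *m W (w i) = sparse_factor i *m us i.+1)].
  by have [us [_ H1 H2]] := H m (leqnn m); exists us.
elim=> [|k IH] km; first by exists (fun _ => u0); split=> // i.
have [us [us0 us1 us2]] := IH (ltnW km).
have usE i : (i <= k)%N -> u0 *m wprod i = sparse_prod i *m us i.
  elim: i => [|i IHi] ik; first by rewrite mulmx1 mul1mx us0.
  by rewrite /= mulmxA IHi 1?ltnW // -mulmxA us2 // mulmxA.
pose H := us k *m W (w k).
have uk := us1 k (leqnn k).
have PH : sparse_prod k *m H = u0 *m wprod k.+1 by rewrite /H mulmxA -usE // -mulmxA.
have unit1 : unitri (1%:M : 'M[F]_n) by move=> a b _; rewrite mxE.
have cmP s : (s <= n)%N -> corner_minor s (wprod k) = corner_minor s (sparse_prod k).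
  move=> sn; rewrite -(corner_minor_unitri _ sn uu0 unit1) mulmx1 usE //.
  by rewrite -[in LHS](mul1mx (sparse_prod k)) corner_minor_unitri.
have leadE c : (n' - k <= c < n)%N -> lead_minor H c.+1 = corner_ratio k c.
  move=> /andP[kc cn].
  have cm0 : corner_minor c.+1 (wprod k) != 0 by apply: corner_neq0 => //; lia.
  (* The last [c.+1] rows of [sparse_prod k] live in the first [c.+1] columns: by the antidiagonal
     bound for rows below index [k], and because [n' - k <= c] for the basis vectors in the other
     rows. *)
  have E : corner_minor c.+1 (wprod k.+1) = corner_minor c.+1 (wprod k) * lead_minor H c.+1.
    rewrite -(corner_minor_unitri _ cn uu0 unit1) mulmx1 -PH corner_minor_mul //; last first.
      move=> a c' ac cc'; have Ha : (inord (n' - a) : 'I_n) = (n' - a)%N :> nat by rewrite inordK //; lia.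
      have := ltn_ord c' => c'n.
      case: (ltnP (n' - a) k) => le; first by rewrite sparse_prod_anti ?Ha //; lia.
      by rewrite sparse_prod_low Ha //; case: eqP => // Ea; lia.
    by rewrite -cmP.
  by rewrite /corner_ratio E mulrC mulKf.
have dn : (n' - k < n)%N by lia.
have [|||u uu uE] := @hessenberg_LU _ _ H _ (n' - k) dn.
- move=> a b ba; rewrite mxE (bigD1 a) //= W_lower // uk // eqxx mul1r big1 ?addr0 // => c Hc.
  case: (leqP c a) => ca; first by rewrite uk // eq_sym (negPf Hc) mul0r.
  by rewrite W_lower ?(ltn_trans ba) // gtn_eqF ?mulr0 //; lia.
(* Row [k] of [sparse_prod k] is the basis vector 0, so row 0 of [H] is row [k] of
   [u0 *m wprod k.+1], where the choice of [u0] provides the zeros. *)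
- move=> b bk; have kn : (k < n)%N by lia.
  have := u0E (Ordinal kn) b; rewrite -PH => <- /=; last by lia.
  rewrite [RHS]mxE (bigD1 ord0) //= sparse_prod_low //= add0n eqxx mul1r big1 ?addr0 // => c Hc.
  rewrite sparse_prod_low //= -[X in X == _]add0n eqn_add2r eq_sym.
  rewrite (_ : (c == 0 :> nat)%N = false) ?mul0r //.
  by apply: contraNF Hc => /eqP Hc; apply/eqP/val_inj.
- move=> c Hc; rewrite leadE // mulf_neq0 ?invr_neq0 //; apply: corner_neq0 => //; lia.
exists (fun i => if i == k.+1 then u else us i); split.
- by rewrite us0.
- by move=> i; rewrite leq_eqVlt; case: eqP => //= _; apply: us1.
move=> i; rewrite ltnS leq_eqVlt => /orP[/eqP->|ik].
  by rewrite eqxx ltn_eqF // -/H uE; congr (_ *m _); apply: eq_Nmat.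
by rewrite !ltn_eqF ?us2 // ltnW.
Qed.

End Whirls.

End CornerMinors.

(** * Minors of the whole unfolded product *)

Section Evolution.
Variables (F : fieldType) (n' k : nat) (w : nat -> 'rV[F]_n'.+1) (g : 'I_k -> nat).
Local Notation n := n'.+1.

Fixpoint evolve (l i : nat) : nat -> 'rV[F]_k :=
  if l is l'.+1 then loopact (W (w i)) (evolve l' i.+1) else base_row F g.

Lemma loopact_block0 (A : 'M_n) (V : nat -> 'rV[F]_k) q : (q < n)%N ->
  loopact A V q = blockact A V q.
Proof.
move=> qn; rewrite /loopact modn_small //; case: q qn => [|q] _.
  by rewrite /= scaler0 addr0.
by rewrite scale0r addr0.
Qed.

(** Position 0 has no predecessor, so block 0 never leaves itself and evolves by the ordinary matrix
    product. The shape invariants are computed this way. *)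
Lemma evolve_block0 l i q : (q < n)%N ->
  blockact (wprod w i) (evolve l i) q = blockact (wprod w (i + l)) (base_row F g) q.
Proof.
elim: l i => [|l IH] i qn; first by rewrite addn0.
rewrite addnS -addSn -IH //= blockact_mul; apply: eq_bigr => c _.
by rewrite divn_small // mul0n add0n loopact_block0.
Qed.

Lemma blockact1 (V : nat -> 'rV[F]_k) : blockact (1%:M : 'M_n) V =1 V.
Proof.
move=> q; rewrite /blockact (bigD1 (inord (q %% n))) //= big1 => [|c Hc].
  by rewrite mxE eqxx scale1r inord_mod -divn_eq addr0.
by rewrite mxE eq_sym (negPf Hc) scale0r.
Qed.

Hypothesis gdec : {homo g : a b / (a < b)%N >-> (b < a)%N}.
Hypothesis gdown : forall a, (0 < g a %% n)%N -> exists b, (g b).+1 = g a.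

(** If some [f a] is not a value of [g], its row is zero; otherwise both maps list the same set in
    decreasing order and the matrix is the identity. No other permutation, hence no sign, can
    occur. *)
Lemma rdet_base_row (f : 'I_k -> nat) : {homo f : a b / (a < b)%N >-> (b < a)%N} ->
  rdet (base_row F g) f = [forall a, f a == g a]%:R.
Proof.
have tr : transitive gtn by move=> x y z /= H1 H2; apply: ltn_trans H2 H1.
have st (h : 'I_k -> nat) : {homo h : a b / (a < b)%N >-> (b < a)%N} ->
    sorted gtn [seq h a | a <- enum 'I_k].
  move=> hdec; rewrite (sorted_pairwise tr) pairwise_map.
  have : pairwise ltn (map val (enum 'I_k)).
    by rewrite -(sorted_pairwise ltn_trans) val_enum_ord iota_ltn_sorted.
  by rewrite pairwise_map; apply: sub_pairwise => a b /hdec.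
move=> fdec; case: (boolP [forall a, [exists b, f a == g b]]) => [/forallP H|]; last first.
  case/forallPn => a /existsPn H.
  have -> : [forall a, f a == g a] = false.
    by apply: contraNF (H a) => /forallP/(_ a).
  rewrite /rdet (expand_det_row _ a) big1 // => b _.
  by rewrite !mxE (negPf (H b)) mul0r.
have E : [seq f a | a <- enum 'I_k] = [seq g a | a <- enum 'I_k].
  apply: (sorted_eq tr); rewrite ?st //; first by move=> x y /andP[/= H1 H2]; lia.
  have uf (h : 'I_k -> nat) : {homo h : a b / (a < b)%N >-> (b < a)%N} -> uniq [seq h a | a <- enum 'I_k].
    by move=> hd; apply: (sorted_uniq tr) (st h hd) => x; rewrite /= ltnn.
  apply: uniq_perm; rewrite ?uf //.
  have [] := uniq_min_size (uf f fdec) (s2 := [seq g a | a <- enum 'I_k]) _ _ => //.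
    move=> _ /mapP[a _ ->]; have /existsP[b /eqP->] := H a.
    by rewrite map_f ?mem_enum.
  by rewrite !size_map.
have Efg a : f a = g a.
  by move/eq_in_map: E => ->; rewrite ?mem_enum.
have -> : [forall a, f a == g a] by apply/forallP => a; rewrite Efg.
rewrite -[RHS](det1 F k); congr (\det _); apply/matrixP => a b; rewrite !mxE Efg.
case: (eqVneq a b) => [->|]; rewrite ?eqxx // => /eqP ab; case: eqP => // Eab.
by case: ab; apply/val_inj; case: (ltngtP a b) => // /gdec; lia.
Qed.

Section EvolvePositive.
Variables (P : F -> Prop) (m : nat).
Hypotheses (P0 : P 0) (P1 : P 1) (PD : forall x y, P x -> P y -> P (x + y))
  (PM : forall x y, P x -> P y -> P (x * y)).
Hypothesis corner_neq0 : forall i s, (i <= m)%N -> (s <= n)%N -> (n <= i + s)%N ->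
  corner_minor s (wprod w i) != 0.
Hypothesis Pratio : forall i, (i < m)%N -> P (corner_ratio w i (n' - i)).
Hypothesis Pratio2 : forall i c, (i < m)%N -> (n' - i < c < n)%N ->
  P (corner_ratio w i c / corner_ratio w i c.-1).

Theorem rdet_evolve_pos (f : 'I_k -> nat) :
  {homo f : a b / (a < b)%N >-> (b < a)%N} ->
  (forall a, ((f a %% n).+1 < n)%N -> exists b, f b = (f a).+1) ->
  P (rdet (evolve m 0) f).
Proof.
move=> fdec fup; have [us uu uE] := whirl_factorization corner_neq0.
pose sevolve := fix sevolve (l i : nat) : nat -> 'rV[F]_k :=
  if l is l'.+1 then loopact (sparse_factor w i) (sevolve l' i.+1)
  else blockact (us i) (base_row F g).
have sE l i : (i + l = m)%N -> blockact (us i) (evolve l i) =1 sevolve l i.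
  elim: l i => [|l IH] i il q //=.
  rewrite loopact_mull ?uE; [|lia|by apply: uu; lia].
  rewrite loopact_mulr; last by apply: uu; lia.
  by apply: eq_loopact; apply: IH; lia.
have ldetE V (K : seq nat) : size K = k -> ldet (map V K) = rdet V (fun a : 'I_k => nth 0%N K a).
  move=> sz; congr (\det _); apply/row_matrixP => a; rewrite !rowK.
  by rewrite (nth_map 0%N) // sz.
have tr : transitive gtn by move=> x y z /= H1 H2; apply: ltn_trans H2 H1.
(* The closure bound [n' - i] is the full final segment condition at [i = 0] and equals the jump
   length of factor [i], as [ldet_step] requires. *)
have Ps l i : (i + l = m)%N -> forall K, sorted gtn K -> size K = k ->
    upclosed n' (n' - i) K -> P (ldet (map (sevolve l i) K)).
  elim: l i => [|l IH] i il K sK szK uK.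
    rewrite ldetE //=; have [|//|T detT ET] := @blockact_base_unitri _ _ _ (us i) g _ gdec.
      by apply: uu; lia.
    rewrite (eq_rdet _ ET) rdet_mulmx detT mulr1.
    rewrite rdet_base_row; first by case: forallP.
    move=> a b ab; move: sK; rewrite (sorted_pairwise tr) => /(pairwiseP 0%N).
    by apply; rewrite // inE szK.
  have im : (i < m)%N by lia.
  apply: (ldet_step P0 PD PM _ (Pratio im)) => //; first by lia.
  - by move=> c; apply: Pratio2.
  - by move=> K' sK' szK' uK'; apply: IH => //; [lia|rewrite subnS].
pose K := [seq f a | a <- enum 'I_k].
have szK : size K = k by rewrite size_map size_enum_ord.
have fK (a : 'I_k) : nth 0%N K a = f a.
  by rewrite (nth_map a) ?size_enum_ord // nth_ord_enum.
rewrite -(rdet_blockact_l _ (uu 0%N (leq0n m)) fdec fup) (eq_rdet _ (sE _ _ _)) //.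
have -> : rdet (sevolve m 0%N) f = ldet (map (sevolve m 0%N) K).
  rewrite ldetE //; congr (\det _); apply/row_matrixP => a; rewrite !rowK.
  by rewrite fK.
apply: Ps => //.
  rewrite (sorted_pairwise tr); apply/(pairwiseP 0%N).
  move=> a b; rewrite !inE szK => ak bk ab.
  by rewrite -[a]/(val (Ordinal ak)) -[b]/(val (Ordinal bk)) !fK; apply: fdec.
move=> q /mapP[a _ ->]; rewrite subn0 -ltnS => /fup[b <-].
by rewrite map_f ?mem_enum.
Qed.
End EvolvePositive.

End Evolution.

(** * Expansion of minors over non-intersecting paths *)

Section PathExpansion.
Variables (F : fieldType) (n' k : nat).
Local Notation n := n'.+1.
Implicit Types (h : 'I_k -> nat) (S : {set 'I_k}) (t : seq {set 'I_k}).

Lemma loopact_W (y : 'rV[F]_n) (V : nat -> 'rV[F]_k) q :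
  loopact (W y) V q = y 0 (inord (q %% n)) *: V q + pred_row V q.
Proof.
(* With [h = 0] only the subdiagonal of [Nmat] survives, so its action is already known. *)
have -> : W y = diag_mx y + Nmat n' 0 (fun=> 0).
  by apply/matrixP => a b; rewrite !mxE mulr0 mul0rn mul0r mul0rn !addr0.
have -> : loopact (diag_mx y + Nmat n' 0 (fun=> 0)) V q
    = blockact (diag_mx y) V q + loopact (Nmat n' 0 (fun=> 0)) V q.
  rewrite /loopact addrA; congr (_ + _); rewrite -big_split; apply: eq_bigr => c _.
  by rewrite mxE scalerDl.
rewrite loopact_Nmat // mulr0 !mul0r !mul0rn !scale0r !addr0; congr (_ + _).
rewrite /blockact (bigD1 (inord (q %% n))) //= big1 => [|c Hc].
  by rewrite mxE eqxx addr0 mulr1n inord_mod -divn_eq.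
by rewrite mxE eq_sym (negPf Hc) mulr0n scale0r.
Qed.

(* At each step the particles a in S stay in place, and the others move down. *)
Definition slide S h a := if a \in S then h a else (h a).-1.

Definition decreasing h := [forall a : 'I_k, forall b : 'I_k, (a < b)%N ==> (h b < h a)%N].

Lemma decreasingP h : reflect {homo h : a b / (a < b)%N >-> (b < a)%N} (decreasing h).
Proof.
apply: (iffP forallP) => [H a b ab|H a]; first by have /forallP/(_ b)/implyP/(_ ab) := H a.
by apply/forallP => b; apply/implyP => /H.
Qed.

Definition slidable S h := [forall a, (a \in S) || (0 < h a)%N] && decreasing (slide S h).

(** Expanding the rows multilinearly gives one term for each set [S] of staying particles. Moves
    have length at most one, so particles cannot cross without first meeting, and a meeting gives
    two equal rows: no sign-reversing involution is required. *)
Lemma rdet_loopact_W (y : 'rV[F]_n) V h : decreasing h ->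
  rdet (loopact (W y) V) h = \sum_(S : {set 'I_k})
    (if slidable S h then \prod_(a in S) y 0 (inord (h a %% n)) * rdet V (slide S h) else 0).
Proof.
move=> /decreasingP hdec.
pose R S := \matrix_(a < k) (if a \in S then V (h a) else pred_row V (h a)).
transitivity (\sum_(S : {set 'I_k}) \prod_(a in S) y 0 (inord (h a %% n)) * \det (R S)).
  rewrite /rdet /determinant.
  under [RHS]eq_bigr do rewrite mulr_sumr.
  rewrite exchange_big; apply: eq_bigr => s _ /=.
  under [RHS]eq_bigr do rewrite mulrCA.
  rewrite -mulr_sumr; congr (_ * _).
  under eq_bigr do rewrite mxE loopact_W mxE [X in X + _]mxE.
  rewrite bigA_distr; apply: eq_bigr => S _.
  rewrite [X in _ = X * _]big_mkcond -big_split; apply: eq_bigr => a _ /=.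
  by rewrite !mxE; case: ifP => //=; rewrite mul1r.
apply: eq_bigr => S _; case: ifP => [/andP[/forallP H _]|H].
  congr (_ * \det _); apply/row_matrixP => a; rewrite !rowK /slide.
  by case: ifP (H a) => //=; case: (h a).
suff -> : \det (R S) = 0 by rewrite mulr0.
case: (boolP [forall a, (a \in S) || (0 < h a)%N]) => H1; last first.
  case/forallPn: H1 => a; rewrite negb_or -eqn0Ngt => /andP[aS /eqP ha].
  by rewrite (expand_det_row _ a) big1 // => b _; rewrite !mxE (negPf aS) ha mxE mul0r.
move: H; rewrite /slidable H1 /= => /negbT/forallPn[a /forallPn[b]].
rewrite negb_imply -leqNgt => /andP[ab le].
have E : slide S h a = slide S h b.
  apply/eqP; rewrite eqn_leq le /=; have := hdec _ _ ab; rewrite /slide.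
  by do 2!case: ifP => _; lia.
apply: (@determinant_alternate _ _ _ a b) => [|c].
  by rewrite -val_eqE ltn_eqF.
have RE d : row d (R S) = V (slide S h d).
  rewrite rowK /slide; case: ifP => // Hd; have /forallP/(_ d) := H1.
  by rewrite Hd /=; case: (h d).
have : row a (R S) 0 c = row b (R S) 0 c by rewrite !RE E.
by rewrite [X in X = _ -> _]mxE [X in _ = X -> _]mxE.
Qed.

Lemma big_tuple_cons (T : finType) l (G : seq T -> F) :
  \sum_(t : l.+1.-tuple T) G t = \sum_(x : T) \sum_(t : l.-tuple T) G (x :: t).
Proof.
rewrite pair_bigA /= (reindex (fun p : T * l.-tuple T => [tuple of p.1 :: p.2])) //.
exists (fun t : l.+1.-tuple T => (thead t, [tuple of behead t])) => [[x t] _|t _] /=.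
  by rewrite theadE; congr (_, _); apply/val_inj.
by rewrite [RHS]tuple_eta; apply/val_inj.
Qed.

Definition stays t a i := count (fun S => a \in S) (take i t).

(** The position at time [i] is [h a + stays t a i - i]; adding [i] throughout avoids truncated
    subtraction and does not affect the comparison of particles. *)
Definition path_to (g h : 'I_k -> nat) t :=
  [forall a, h a + stays t a (size t) == g a + size t]%N &&
  [forall i : 'I_(size t).+1, decreasing (fun a => h a + stays t a i)%N].

Variables (w : nat -> 'rV[F]_n) (g : 'I_k -> nat).

Definition path_weight i0 h t : F :=
  \prod_(i < size t) \prod_(a in nth set0 t i)
    w (i0 + i)%N 0 (inord ((h a + stays t a i - i) %% n)).

Lemma path_to_cons h S t : decreasing h ->
  path_to g h (S :: t) = slidable S h && path_to g (slide S h) t.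
Proof.
move=> hdec; rewrite /path_to /slidable /= /stays /=.
case: (boolP [forall a, (a \in S) || (0 < h a)%N]) => [/forallP H|/forallPn[a]]; last first.
  rewrite negb_or -eqn0Ngt => /andP[aS /eqP ha]; apply/negbTE.
  apply/nandP; left; apply/forallPn; exists a; rewrite (negPf aS) ha !add0n.
  by rewrite take_size neq_ltn (leq_ltn_trans (count_size _ _)) // addnS ltnS leq_addl.
have sl a : (h a + (a \in S) = (slide S h a).+1)%N.
  by rewrite /slide; have := H a; case: ifP => /=; lia.
have -> : [forall a, h a + ((a \in S) + count (fun S0 => a \in S0) (take (size t) t)) == g a + (size t).+1]%N
   = [forall a, slide S h a + count (fun S0 => a \in S0) (take (size t) t) == g a + size t]%N.
  by apply: eq_forallb => a; rewrite addnA sl addnS addSn eqSS.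
rewrite /= andbCA; congr (_ && _); apply/forallP/andP => [D|[D0 D] [[|i] Hi]] /=.
- split.
    have /decreasingP D1 := D (@Ordinal (size t).+2 1 isT); apply/decreasingP => a b /D1.
    by rewrite /= take0 /= !addn0 !sl.
  apply/forallP => i; have /decreasingP D1 := D (lift ord0 i).
  by apply/decreasingP => a b /D1; rewrite /= !addnA !sl !addSn.
- by apply/decreasingP => a b; rewrite !addn0; apply/decreasingP.
- have /forallP/(_ (Ordinal (Hi : i < (size t).+1)%N))/decreasingP D1 := D.
  by apply/decreasingP => a b /D1; rewrite /= !addnA !sl !addSn.
Qed.

Lemma path_weight_cons i0 h S t : (forall a, (a \in S) || (0 < h a)%N) ->
  path_weight i0 h (S :: t) =
  \prod_(a in S) w i0 0 (inord (h a %% n)) * path_weight i0.+1 (slide S h) t.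
Proof.
move=> H; rewrite /path_weight big_ord_recl /= addn0; congr (_ * _).
  by apply: eq_bigr => a _; rewrite /stays /= addn0 subn0.
apply: eq_bigr => i _; apply: eq_bigr => a _; rewrite /bump /= add1n addnS -addSn.
congr (w _ _ (inord (_ %% _))).
rewrite /stays /= /slide; have := H a; case: ifP => /= _; first by rewrite add1n addnS subSS.
by case: (h a) => // ha _; rewrite add0n addSn subSS.
Qed.

Hypothesis gdec : {homo g : a b / (a < b)%N >-> (b < a)%N}.

Lemma rdet_evolveE l i h : decreasing h ->
  rdet (evolve w g l i) h =
  \sum_(t : l.-tuple {set 'I_k} | path_to g h t) path_weight i h t.
Proof.
move=> hdec; rewrite [RHS]big_mkcond /=.
elim: l i h hdec => [|l IH] i h hdec.
  rewrite /= rdet_base_row //; last exact/decreasingP.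
  rewrite (big_pred1 [tuple]) => [|t]; last by apply/esym/eqP/val_inj; case: t => -[].
  rewrite /path_to /path_weight big_ord0 /=; rewrite [X in _ && X](_ : _ = true).
    rewrite andbT (_ : [forall a, h a + stays [::] a 0 == g a + 0]%N = [forall a, h a == g a]).
      by case: forallP.
    by apply: eq_forallb => a; rewrite /stays !addn0.
  by apply/forallP => j; apply/decreasingP => a b; rewrite /stays /= !addn0; apply/decreasingP.
rewrite (big_tuple_cons l (fun t => if path_to g h t then path_weight i h t else 0)).
rewrite /= rdet_loopact_W //; apply: eq_bigr => S _.
under [RHS]eq_bigr do rewrite path_to_cons //.
case: ifP => [|_]; last by rewrite big1.
move=> /andP[/forallP H D] /=; rewrite IH // mulr_sumr; apply: eq_bigr => t _.
by case: ifP => _; rewrite ?mulr0 // path_weight_cons.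
Qed.

End PathExpansion.

(** * Tableaux and paths *)

Section Stays.
Variables (k : nat).
Implicit Types (t : seq {set 'I_k}) (a : 'I_k).

Lemma staysS t a i : (i < size t)%N -> stays t a i.+1 = (stays t a i + (a \in nth set0 t i))%N.
Proof. by move=> lt; rewrite /stays (take_nth set0) // -cats1 count_cat /= addn0. Qed.

Lemma stays_mono t a i j : (i <= j)%N -> (stays t a i <= stays t a j)%N.
Proof.
by move=> /subnKC <-; rewrite /stays takeD count_cat leq_addr.
Qed.

Lemma stays_lip t a i : (stays t a (size t) <= stays t a i + (size t - i))%N.
Proof.
rewrite /stays take_size -{1}(cat_take_drop i t) count_cat leq_add2l -size_drop.
exact: count_size.
Qed.

Lemma stays_reach t a r j : (j <= size t)%N -> (r < stays t a j)%N ->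
  exists2 i, (i < j)%N & (a \in nth set0 t i) && (stays t a i == r).
Proof.
elim: j => [|j IH] jt; first by rewrite /stays take0.
rewrite staysS // => lt; case: (ltnP r (stays t a j)) => H.
  by have [i ij Hi] := IH (ltnW jt) H; exists i => //; apply: ltnW.
by exists j => //; move: lt; case: (a \in _) => /=; lia.
Qed.

Lemma stays_inj t a i j : (i < size t)%N -> (j < size t)%N ->
  a \in nth set0 t i -> a \in nth set0 t j -> stays t a i = stays t a j -> i = j.
Proof.
have aux i' j' : (i' < j')%N -> (i' < size t)%N -> a \in nth set0 t i' ->
    (stays t a i' < stays t a j')%N.
  by move=> ij it ai; apply: leq_trans (stays_mono _ _ ij); rewrite staysS // ai addn1.
move=> it jt ai aj E; case: (ltngtP i j) => // H.
  by have := aux _ _ H it ai; rewrite E ltnn.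
by have := aux _ _ H jt aj; rewrite E ltnn.
Qed.

End Stays.

Section Columns.
(** For [c > 0] this is the part of index [c] of the conjugate partition. *)
Definition col_height (s : seq nat) (c : nat) : nat := count (leq c) s.

Lemma col_heightE s a c : is_partition s -> (0 < c)%N ->
  (c <= nth 0 s a)%N = (a < col_height s c)%N.
Proof.
move=> sp c0; elim: s a sp => [|x s IH] a sp /=.
  by rewrite nth_nil leqNgt c0.
have tr : transitive geq by move=> u v z /= H1 H2; apply: leq_trans H2 H1.
have sp' : is_partition s by apply: path_sorted sp.
case: (leqP c x) => cx.
  by case: a => [|a] //=; rewrite IH // add1n.
have all_lt : all (fun y => y < c)%N s.
  have := sp; rewrite /is_partition /= (path_sortedE tr) => /andP[H _].
  by apply: sub_all H => y /= yx; apply: leq_ltn_trans cx.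
have -> : col_height s c = 0%N.
  apply/eqP; rewrite -leqn0 leqNgt -has_count; apply/hasPn => y /(allP all_lt).
  by rewrite -ltnNge.
case: a => [|a] /=; first by rewrite leqNgt cx.
rewrite !add0n; apply/negbTE; rewrite -ltnNge.
by case: (ltnP a (size s)) => H; [apply: (allP all_lt); apply: mem_nth|rewrite nth_default].
Qed.

Lemma col_height_anti s c c' : (c <= c')%N -> (col_height s c' <= col_height s c)%N.
Proof. by move=> cc; apply: sub_count => y /=; apply: leq_trans. Qed.

Variables (la mu : seq nat).
Hypothesis skewP : skew_shape la mu.

Lemma in_skewE a c : (0 < c)%N ->
  in_skew la mu a c = (col_height mu c < a <= col_height la c)%N.
Proof.
case: skewP => pla pmu _ c0; rewrite /in_skew; case: a => [|a] //=.
by rewrite ltnNge !col_heightE // -leqNgt ltnS.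
Qed.

Lemma in_skew_gt0 a c : in_skew la mu a c -> (0 < c)%N.
Proof. by rewrite /in_skew => /and3P[_ lt _]; apply: leq_ltn_trans lt. Qed.

(* Empty columns are discarded: they carry no weight, and the corner color
   condition does not constrain them. *)
Definition columns : seq nat :=
  [seq c <- iota 1 (head 0 la) | (col_height mu c < col_height la c)%N].

Lemma mem_columns c : (c \in columns) = (0 < c)%N && (col_height mu c < col_height la c)%N.
Proof.
rewrite mem_filter mem_iota andbC add1n ltnS -andbA; congr (_ && _).
case: (ltnP (col_height mu c)) => H; rewrite ?andbF // andbT.
case: skewP => pla _ _; case: (posnP c) => [->//|c0].
by rewrite -nth0 col_heightE //; apply: leq_ltn_trans H.
Qed.

Lemma columns_sorted : sorted ltn columns.
Proof. by apply: sorted_filter; [exact: ltn_trans|exact: iota_ltn_sorted]. Qed.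

Lemma cell_exists a c : in_skew la mu a c ->
  exists2 s : cell la mu, cell_row s = a & cell_col s = c.
Proof.
move=> H; have c0 := in_skew_gt0 H.
have := H; rewrite in_skewE // => /andP[Hlo Hhi].
have Ha : (a < (size la).+1)%N by rewrite ltnS (leq_trans Hhi) // count_size.
have Hc : (c < (head 0%N la).+1)%N.
  rewrite ltnS -nth0 col_heightE //; first by apply: leq_trans Hhi; apply: leq_ltn_trans Hlo.
  by case: skewP.
by exists (exist _ (Ordinal Ha, Ordinal Hc) H).
Qed.

Lemma cell_inj (s s' : cell la mu) : cell_row s = cell_row s' -> cell_col s = cell_col s' -> s = s'.
Proof.
case: s s' => [[a c] p] [[a' c'] p'] /= Ea Ec; apply/val_inj => /=.
by congr (_, _); apply/val_inj.
Qed.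

Lemma cell_col_gt0 (s : cell la mu) : (0 < cell_col s)%N.
Proof. exact: in_skew_gt0 (valP s). Qed.

Lemma cell_rowP (s : cell la mu) :
  (col_height mu (cell_col s) < cell_row s <= col_height la (cell_col s))%N.
Proof. by rewrite -in_skewE ?cell_col_gt0 //; exact: valP s. Qed.

Lemma cell_col_mem (s : cell la mu) : cell_col s \in columns.
Proof.
by rewrite mem_columns cell_col_gt0; have /andP[H1 H2] := cell_rowP s; apply: leq_trans H2.
Qed.

Local Notation k := (size columns).

Definition column (a : 'I_k) : nat := nth 0%N columns a.
Definition col_lo (a : 'I_k) : nat := col_height mu (column a).
Definition col_hi (a : 'I_k) : nat := col_height la (column a).

Lemma column_lt (a b : 'I_k) : (a < b)%N -> (column a < column b)%N.
Proof.
move=> ab; have := columns_sorted; rewrite (sorted_pairwise ltn_trans) => /(pairwiseP 0%N).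
by apply; rewrite ?inE.
Qed.

Lemma column_inj : injective column.
Proof.
by move=> a b E; apply/val_inj; case: (ltngtP a b) => // /column_lt; rewrite E ltnn.
Qed.

Lemma column_mono (a b : 'I_k) : (column a < column b)%N -> (a < b)%N.
Proof.
move=> H; case: (ltngtP a b) => // [/column_lt H'|/val_inj E]; last by rewrite E ltnn in H.
by have := ltn_trans H H'; rewrite ltnn.
Qed.

Lemma column_gt0 a : (0 < column a)%N.
Proof. by have := mem_nth 0%N (ltn_ord a); rewrite mem_columns => /andP[]. Qed.

Lemma lo_hi a : (col_lo a < col_hi a)%N.
Proof. by have := mem_nth 0%N (ltn_ord a); rewrite mem_columns => /andP[]. Qed.

Definition cell_index (s : cell la mu) : 'I_k :=
  Ordinal (etrans (index_mem _ _) (cell_col_mem s)).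

Lemma column_index s : column (cell_index s) = cell_col s.
Proof. by rewrite /column nth_index // cell_col_mem. Qed.

Lemma cell_indexP s : (col_lo (cell_index s) < cell_row s <= col_hi (cell_index s))%N.
Proof. by rewrite /col_lo /col_hi column_index cell_rowP. Qed.

Lemma cell_at (a : 'I_k) r : (col_lo a < r <= col_hi a)%N ->
  exists2 s : cell la mu, cell_row s = r & cell_index s = a.
Proof.
move=> H; have [|s Er Ec] := @cell_exists r (column a).
  by rewrite in_skewE ?column_gt0.
by exists s => //; apply: column_inj; rewrite column_index.
Qed.

Lemma card_cells_above (a : 'I_k) r : (col_lo a <= r <= col_hi a)%N ->
  #|[set s | (cell_index s == a) && (cell_row s <= r)%N]| = (r - col_lo a)%N.
Proof.
move=> /andP[lr rh]; rewrite -(size_iota (col_lo a).+1 (r - col_lo a)) cardE.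
rewrite -(size_map (@cell_row la mu)); apply/perm_size/uniq_perm.
- rewrite map_inj_in_uniq ?enum_uniq // => s s'; rewrite !mem_enum !inE.
  move=> /andP[/eqP E _] /andP[/eqP E' _] Er.
  by apply: cell_inj => //; rewrite -!column_index E E'.
- exact: iota_uniq.
move=> y; rewrite mem_iota; apply/mapP/idP => [[s]|H].
  rewrite mem_enum inE => /andP[/eqP E Hr] ->; have := cell_indexP s; rewrite E; lia.
have [|s Er Es] := @cell_at a y; first by lia.
by exists s; rewrite // mem_enum inE Es eqxx Er; lia.
Qed.

End Columns.

Section TableauxPaths.
Variables (F : fieldType) (m' n' : nat) (X : 'M[F]_(m'.+1, n'.+1)).
Variables (la mu : seq nat) (skewP : skew_shape la mu).
Local Notation m := m'.+1.
Local Notation n := n'.+1.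
Local Notation k := (size (columns la mu)).
Local Notation cidx := (cell_index skewP).
Local Notation col_lo := (@col_lo la mu).
Local Notation col_hi := (@col_hi la mu).
Local Notation column := (@column la mu).
Implicit Types (T : {ffun cell la mu -> 'I_m}) (t : m.-tuple {set 'I_k}) (a b : 'I_k).

(* The particle of a column stays in place at step i iff i occurs in the
   column. *)
Definition tab_path T : m.-tuple {set 'I_k} :=
  [tuple [set a | [exists s, (cidx s == a) && (T s == i)]] | i < m].

(** The cells of a column, from top to bottom, receive the times of its successive stays. The
    default [ord0] is never reached when [t] is a path with the prescribed ends. *)
Definition path_tab t : {ffun cell la mu -> 'I_m} :=
  [ffun s => odflt ord0 [pick i : 'I_m | (cidx s \in nth set0 t i)
      && (stays t (cidx s) i == cell_row s - (col_lo (cidx s)).+1)%N]].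

Lemma nth_tab_path T (i : 'I_m) a :
  (a \in nth set0 (tab_path T) i) = [exists s, (cidx s == a) && (T s == i)].
Proof. by rewrite -tnth_nth tnth_mktuple inE. Qed.

Section FromTableau.
Variable T : {ffun cell la mu -> 'I_m}.
Hypothesis sT : semistandard T.

Lemma tab_col s s' : cidx s = cidx s' -> (cell_row s < cell_row s')%N -> (T s < T s')%N.
Proof.
move=> E lt; have /forallP/(_ s)/forallP/(_ s')/andP[_ /implyP] := sT.
by apply; rewrite lt -!(column_index skewP) E eqxx.
Qed.

Lemma tab_row s s' : cell_row s = cell_row s' -> (cidx s < cidx s')%N -> (T s <= T s')%N.
Proof.
move=> E lt; have /forallP/(_ s)/forallP/(_ s')/andP[/implyP + _] := sT.
by apply; rewrite E eqxx -!(column_index skewP) column_lt.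
Qed.

Lemma tab_col_ltn s s' : cidx s = cidx s' -> (T s < T s')%N = (cell_row s < cell_row s')%N.
Proof.
move=> E; case: (ltngtP (cell_row s) (cell_row s')) => H; first exact: tab_col.
  by have := tab_col (esym E) H; case: ltngtP.
suff -> : s = s' by rewrite ltnn.
by apply: cell_inj => //; rewrite -!(column_index skewP) E.
Qed.

Lemma tab_cell_inj s s' : cidx s = cidx s' -> T s = T s' -> s = s'.
Proof.
move=> E Ts; apply: cell_inj; last by rewrite -!(column_index skewP) E.
have := tab_col_ltn E; have := tab_col_ltn (esym E); rewrite Ts ltnn.
by case: ltngtP.
Qed.

Lemma stays_tab_path a i : (i <= m)%N ->
  stays (tab_path T) a i = #|[set s | (cidx s == a) && (T s < i)%N]|.
Proof.
elim: i => [|i IH] im.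
  by rewrite /stays take0 /= eq_card0 // => s; rewrite inE andbF.
rewrite staysS ?size_tuple // IH 1?ltnW // -[ i ]/(val (Ordinal im)) nth_tab_path /=.
have -> : [set s | (cidx s == a) && (T s < i.+1)%N] =
   [set s | (cidx s == a) && (T s < i)%N] :|: [set s | (cidx s == a) && (T s == Ordinal im)].
  apply/setP => s; rewrite !inE ltnS leq_eqVlt -andb_orr orbC.
  by congr (_ && (_ || _)).
rewrite cardsU [X in (_ - #|pred_of_set X|)%N](_ : _ = set0) ?cards0 ?subn0; last first.
  apply/setP => s; rewrite !inE; apply/negP => /andP[/andP[_ lt] /andP[_ /eqP E]].
  by rewrite E ltnn in lt.
congr (_ + _)%N; case: existsP => [[s /andP[/eqP Es /eqP Ts]]|H].
  rewrite [X in #|pred_of_set X|](_ : _ = [set s]) ?cards1 //; apply/setP => s'; rewrite !inE.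
  apply/andP/eqP => [[/eqP Es' /eqP Ts']|->]; last by rewrite Es Ts.
  by apply: tab_cell_inj; rewrite ?Es ?Ts.
rewrite [X in #|pred_of_set X|](_ : _ = set0) ?cards0 //; apply/setP => s; rewrite !inE.
by apply/negP => Hs; apply: H; exists s.
Qed.

Lemma stays_tab_cell s : (stays (tab_path T) (cidx s) (T s) + (col_lo (cidx s)).+1)%N = cell_row s.
Proof.
rewrite stays_tab_path; last exact: ltnW.
have /andP[H1 H2] := cell_indexP skewP s.
rewrite [X in #|pred_of_set X|](_ : _ = [set s' | (cidx s' == cidx s) && (cell_row s' <= (cell_row s).-1)%N]).
  by rewrite card_cells_above //; lia.
apply/setP => s'; rewrite !inE; case: eqP => //= E; rewrite tab_col_ltn //.
by case: (cell_row s) H1.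
Qed.

Lemma stays_tab_full a : (stays (tab_path T) a m + col_lo a)%N = col_hi a.
Proof.
have := lo_hi skewP a => H; rewrite stays_tab_path //.
rewrite [X in #|pred_of_set X|](_ : _ = [set s' | (cidx s' == a) && (cell_row s' <= col_hi a)%N]).
  by rewrite card_cells_above //; lia.
apply/setP => s'; rewrite !inE ltn_ord; case: eqP => //= E.
by have := cell_indexP skewP s'; rewrite E => /andP[_ ->].
Qed.

Lemma tab_pathK : path_tab (tab_path T) = T.
Proof.
apply/ffunP => s; rewrite ffunE; have E := stays_tab_cell s.
have mem : cidx s \in nth set0 (tab_path T) (T s).
  by rewrite nth_tab_path; apply/existsP; exists s; rewrite !eqxx.
case: pickP => [i /andP[H1 /eqP H2]|/(_ (T s))]; last first.
  by rewrite mem -E addnK eqxx.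
apply/val_inj/(stays_inj _ _ H1 mem); rewrite ?size_tuple ?ltn_ord //.
by rewrite H2 -E addnK.
Qed.

(** Both sides are the last rows filled with entries below [i]. The cell of column [a] in row [rho],
    if it is in the shape, has an entry no larger than that of column [b], hence is filled as
    well. *)
Lemma stays_tab_le a b i : (i <= m)%N -> (a < b)%N ->
  (col_lo b + stays (tab_path T) b i <= col_lo a + stays (tab_path T) a i)%N.
Proof.
move=> im ab; case: (leqP (col_lo b + stays (tab_path T) b i) (col_lo a)) => [H|H].
  by apply: leq_trans H _; rewrite leq_addr.
set rho := (col_lo b + _)%N in H *.
have cab : (column a <= column b)%N by apply/ltnW/column_lt.
have lo_ab : (col_lo b <= col_lo a)%N by apply: col_height_anti.
have hi_ab : (col_hi b <= col_hi a)%N by apply: col_height_anti.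
have rho_hi : (rho <= col_hi b)%N.
  by rewrite /rho -(stays_tab_full b) addnC leq_add2r stays_mono.
have [|s Er Es] := @cell_at _ _ skewP a rho; first by lia.
have [|s' Er' Es'] := @cell_at _ _ skewP b rho; first by lia.
have le : (T s <= T s')%N by apply: tab_row; rewrite ?Er ?Er' ?Es ?Es'.
have ltT : (T s' < i)%N.
  rewrite ltnNge; apply/negP => iT.
  have := stays_mono (tab_path T) b iT; have := stays_tab_cell s'; rewrite Es' Er'.
  by rewrite /rho; lia.
have Ts : (T s < i)%N by apply: leq_ltn_trans le ltT.
have := stays_mono (tab_path T) a Ts; rewrite staysS ?size_tuple //.
have -> : a \in nth set0 (tab_path T) (T s).
  by rewrite nth_tab_path; apply/existsP; exists s; rewrite Es !eqxx.
have := stays_tab_cell s; rewrite Es Er; lia.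
Qed.

End FromTableau.

(* R is congruent to r modulo n, and large enough for the positions to be
   natural numbers. *)
Variable R : nat.
Hypothesis R_column : forall a, (column a <= R)%N.
Hypothesis R_hi : forall a, (column a + m <= col_hi a + R)%N.

Definition start_pos a := (col_lo a + R - column a)%N.
Definition end_pos a := (col_hi a + R - column a - m)%N.

Lemma start_pos_decr : decreasing start_pos.
Proof.
apply/decreasingP => a b ab; have := column_lt ab.
have : (col_lo b <= col_lo a)%N by apply/col_height_anti/ltnW/column_lt.
by have := R_column a; have := R_column b; rewrite /start_pos; lia.
Qed.

Lemma end_pos_decr : {homo end_pos : a b / (a < b)%N >-> (b < a)%N}.
Proof.
move=> a b ab; have := column_lt ab.
have : (col_hi b <= col_hi a)%N by apply/col_height_anti/ltnW/column_lt.
by have := R_hi a; have := R_hi b; rewrite /end_pos; lia.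
Qed.

Lemma tab_path_to T : semistandard T -> path_to end_pos start_pos (tab_path T).
Proof.
move=> sT; apply/andP; split; [apply/forallP => a|apply/forallP => i].
  rewrite size_tuple; apply/eqP; have := stays_tab_full sT a.
  by have := R_column a; have := R_hi a; rewrite /start_pos /end_pos; lia.
apply/decreasingP => a b ab; have im : (i <= m)%N.
  have le : (i <= size (tab_path T))%N by rewrite -ltnS ltn_ord.
  by apply: leq_trans le _; rewrite size_tuple.
have := stays_tab_le sT im ab; have := column_lt ab.
by have := R_column a; have := R_column b; rewrite /start_pos; lia.
Qed.

Section FromPath.
Variable t : m.-tuple {set 'I_k}.
Hypothesis tP : path_to end_pos start_pos t.

Lemma stays_full a : (stays t a m + col_lo a)%N = col_hi a.
Proof.
have /andP[/forallP/(_ a)] := tP; rewrite size_tuple => /eqP + _.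
by have := lo_hi skewP a; have := R_column a; have := R_hi a; rewrite /start_pos /end_pos; lia.
Qed.

Lemma path_tabP s : cidx s \in nth set0 t (path_tab t s) /\
  (stays t (cidx s) (path_tab t s) + (col_lo (cidx s)).+1)%N = cell_row s.
Proof.
have /andP[H1 H2] := cell_indexP skewP s.
rewrite /path_tab ffunE; case: pickP => [i /andP[H /eqP ->]|H] /=.
  by split=> //; lia.
have [||i im Hi] := @stays_reach _ t (cidx s) (cell_row s - (col_lo (cidx s)).+1) m.
- by rewrite size_tuple.
- by have := stays_full (cidx s); lia.
by have := H (Ordinal im); rewrite Hi.
Qed.

Lemma path_tabK : tab_path (path_tab t) = t.
Proof.
apply/eq_from_tnth => i; apply/setP => a; rewrite !(tnth_nth set0) nth_tab_path.
apply/existsP/idP => [[s /andP[/eqP <- /eqP <-]]|H]; first by case: (path_tabP s).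
have lt : (stays t a i + col_lo a < col_hi a)%N.
  rewrite -(stays_full a) ltn_add2r (leq_trans _ (stays_mono _ _ (ltn_ord i))) //.
  by rewrite staysS ?size_tuple // H addn1.
have [|s Er Es] := @cell_at _ _ skewP a (stays t a i + (col_lo a).+1); first by lia.
exists s; rewrite Es eqxx /=; have [] := path_tabP s; rewrite Es Er => H1 H2.
by apply/eqP/val_inj/(stays_inj _ _ H1 H); rewrite ?size_tuple ?ltn_ord //; lia.
Qed.

Lemma path_tab_semistandard : semistandard (path_tab t).
Proof.
apply/forallP => s; apply/forallP => s'.
have [M1 E1] := path_tabP s; have [M2 E2] := path_tabP s'.
apply/andP; split; apply/implyP => /andP[/eqP Er lt]; last first.
  have E : cidx s = cidx s' by apply: column_inj => //; rewrite !column_index.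
  rewrite ltnNge; apply/negP => le; have := stays_mono t (cidx s) le.
  by move: E1 E2; rewrite E; lia.
set i := path_tab t s' in M2 E2 *.
have im : (i.+1 <= size t)%N by rewrite size_tuple.
(* Non-intersection gives the sharp bound only for columns at distance 1, so the comparison walks
   left one column at a time; the columns in between are nonempty since the shape contains the whole
   row segment. *)
have chain d : (cell_col s + d <= cell_col s')%N ->
  forall a, column a = (cell_col s' - d)%N -> (cell_row s <= col_lo a + stays t a i.+1)%N.
  elim: d => [|d IH] dle a Ea.
    have -> : a = cidx s' by apply: (@column_inj la mu); rewrite column_index Ea subn0.
    by rewrite staysS // M2; lia.
  have [s1 R1 C1] : exists2 s1 : cell la mu, cell_row s1 = cell_row s & cell_col s1 = (cell_col s' - d)%N.
    apply: (cell_exists skewP).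
    have c0 := cell_col_gt0 s; rewrite in_skewE //; last by lia.
    have /andP[A1 A2] := cell_rowP skewP s; have /andP[B1 B2] := cell_rowP skewP s'.
    apply/andP; split; first by apply: leq_ltn_trans A1; apply: col_height_anti; lia.
    by rewrite Er; apply: leq_trans B2 _; apply: col_height_anti; lia.
  have Hb : column (cidx s1) = (cell_col s' - d)%N by rewrite column_index.
  have ab : (a < cidx s1)%N by apply: column_mono; rewrite Hb Ea; lia.
  have le := IH (ltnW (_ : (cell_col s + d < cell_col s')%N)) (cidx s1) Hb.
  have {}le := le ltac:(lia).
  have /andP[_ /forallP/(_ (Ordinal (im : (i.+1 < (size t).+1)%N)))/decreasingP/(_ _ _ ab)] := tP.
  have := R_column a; have := R_column (cidx s1); rewrite /start_pos /= Hb Ea; lia.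
have {}chain := chain (cell_col s' - cell_col s)%N _ (cidx s).
rewrite column_index in chain.
have {}chain := chain ltac:(lia) ltac:(lia).
rewrite leqNgt; apply/negP => lti; have := stays_mono t (cidx s) lti.
by move: E1 chain; lia.
Qed.

End FromPath.

Variables (r : int) (Rr : (R%:Z = r %[mod n%:Z])%Z).

Lemma loop_varE (i : 'I_m) (rr : int) (q : nat) :
  (q%:Z + i.+1%:Z = rr %[mod n%:Z])%Z -> loop_var X i rr = X i (inord (q %% n)).
Proof.
move=> E; rewrite /loop_var; case: pickP => [j /eqP Hj|/(_ (inord (q %% n)))].
  congr (X _ _); apply/val_inj; rewrite /= inord_mod.
  have E1 : (j%:Z = q%:Z %[mod n%:Z])%Z.
    apply/eqP; rewrite -(eqz_modDr i.+1%:Z) E; apply/eqP.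
    have -> : (j%:Z + i.+1%:Z = j.+1%:Z + (i.+1%:Z - 1))%R by lia.
    by rewrite -modzDml Hj modzDml; congr (_ %% _)%Z; lia.
  by move: E1; rewrite !modz_nat => -[]; rewrite modn_small.
case/negP; apply/eqP; rewrite inord_mod.
have -> : (rr - i.+1%:Z + 1 = (rr + (1 - i.+1%:Z)))%R by lia.
rewrite -modzDml -E modzDml.
have -> : ((q %% n).+1%:Z = (q %% n)%N%:Z + 1)%R by lia.
by rewrite -modz_nat modzDml; congr (_ %% _)%Z; lia.
Qed.

(** When a cell with entry [i] is filled, its particle is at row minus column plus [R] minus [i.+1]:
    the color of the cell shifted exactly as in [loop_var]. *)
Lemma tab_weight T : semistandard T ->
  \prod_(s : cell la mu) loop_var X (T s) (content (cell_row s) (cell_col s) + r) =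
  path_weight (fun i => row (inord i) X) 0 start_pos (tab_path T).
Proof.
move=> sT; have tP := tab_path_to sT.
rewrite /path_weight pair_big_dep /=.
pose h (s : cell la mu) : 'I_(size (tab_path T)) * 'I_k :=
  (cast_ord (esym (size_tuple (tab_path T))) (T s), cidx s).
rewrite (partition_big h (fun p => p.2 \in nth set0 (tab_path T) p.1)) => [|s _]; last first.
  by rewrite /= nth_tab_path; apply/existsP; exists s; rewrite !eqxx.
apply: eq_bigr => -[i a] /= H.
have im : (i < m)%N by apply: leq_trans (ltn_ord i) _; rewrite size_tuple.
have := H; rewrite -[i : nat]/(val (Ordinal im)) nth_tab_path => /existsP[s /andP[/eqP Es /eqP Ts]].
have Ei : cast_ord (esym (size_tuple (tab_path T))) (T s) = i by apply/val_inj; rewrite /= Ts.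
rewrite (big_pred1 s) => [|s']; last first.
  rewrite /h; apply/eqP/eqP => [[E1 E2]|->]; last by rewrite Ei Es.
  by apply: (tab_cell_inj sT); [rewrite E2 Es|apply/val_inj; rewrite Ts -[RHS]/(val i) -E1].
have Ecell := stays_tab_cell sT s; rewrite Es Ts -[nat_of_ord (Ordinal im)]/(nat_of_ord i) in Ecell.
have lip j : (stays (tab_path T) a m <= stays (tab_path T) a j + (m - j))%N.
  by have := stays_lip (tab_path T) a j; rewrite size_tuple.
have {}lip := lip i.
have := stays_tab_full sT a => full.
have Ecol : cell_col s = column a by rewrite -Es column_index.
rewrite (loop_varE (q := start_pos a + stays (tab_path T) a i - i)).
  by rewrite mxE Ts; congr (X _ _); apply/val_inj; rewrite /= inordK.
have -> : (content (cell_row s) (cell_col s) + r = r + content (cell_row s) (cell_col s))%R by rewrite addrC.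
rewrite -[RHS]modzDml -Rr modzDml; congr (_ %% _)%Z.
rewrite /content Ts -[nat_of_ord (Ordinal im)]/(nat_of_ord i) Ecol -Ecell; have := R_column a; have := R_hi a.
rewrite /start_pos; lia.
Qed.

Theorem loop_schur_rdet : loop_schur X la mu r =
  rdet (evolve (fun i => row (inord i) X) end_pos m 0) start_pos.
Proof.
rewrite rdet_evolveE; [|exact: end_pos_decr|exact: start_pos_decr].
rewrite (reindex_onto tab_path path_tab); last by move=> t /path_tabK.
apply: eq_big => [T|T sT]; last exact: tab_weight.
apply/idP/andP => [sT|[tP /eqP <-]]; first by rewrite tab_path_to ?tab_pathK.
exact: path_tab_semistandard.
Qed.

End TableauxPaths.

(** * Positive Laurent polynomials in the Q-pattern *)

Section LaurentSums.
Variables (F : fieldType) (I : finType) (z : I -> F).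

(** Coefficients are encoded by repetition of exponents, which makes closure under sum a
    concatenation. *)
Definition laurent_sum (f : F) :=
  exists s : seq {ffun I -> int}, f = \sum_(e <- s) \prod_(k : I) z k ^ e k.

Lemma laurent_sum_positive f : laurent_sum f -> positive_laurent z f.
Proof.
move=> [s ->]; exists (undup s), (fun e => count_mem e s); split.
- exact: undup_uniq.
- by move=> e; rewrite mem_undup -has_pred1 has_count.
rewrite -[LHS]big_undup_iterop_count; apply: eq_bigr => e _.
by rewrite mulr_natl.
Qed.

Lemma laurent_sum0 : laurent_sum 0.
Proof. by exists [::]; rewrite big_nil. Qed.

Lemma laurent_sum1 : laurent_sum 1.
Proof.
by exists [:: [ffun=> 0]]; rewrite big_seq1 big1 // => k _; rewrite ffunE expr0z.
Qed.

Lemma laurent_sumD f g : laurent_sum f -> laurent_sum g -> laurent_sum (f + g).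
Proof. by move=> [s ->] [t ->]; exists (s ++ t); rewrite big_cat. Qed.

Hypothesis z_neq0 : forall k, z k != 0.

Lemma laurent_sumM f g : laurent_sum f -> laurent_sum g -> laurent_sum (f * g).
Proof.
move=> [s ->] [t ->]; exists (allpairs (fun e e' : {ffun I -> int} => [ffun k => e k + e' k]) s t).
rewrite big_allpairs_dep mulr_suml; apply: eq_bigr => e _.
rewrite mulr_sumr; apply: eq_bigr => e' _; rewrite -big_split; apply: eq_bigr => k _.
by rewrite ffunE expfzDr.
Qed.

Lemma laurent_sum_var k : laurent_sum (z k).
Proof.
exists [:: [ffun l => (l == k)%:Z]]; rewrite big_seq1 (bigD1 k) //= big1 => [|l lk].
  by rewrite ffunE eqxx expr1z mulr1.
by rewrite ffunE (negPf lk) expr0z.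
Qed.

Lemma laurent_sum_varV k : laurent_sum (z k)^-1.
Proof.
exists [:: [ffun l => - (l == k)%:Z]]; rewrite big_seq1 (bigD1 k) //= big1 => [|l lk].
  by rewrite ffunE eqxx mulr1 exprN1.
by rewrite ffunE (negPf lk) oppr0 expr0z.
Qed.

End LaurentSums.

Section QPattern.
Variables (F : fieldType) (m' n' : nat) (X : 'M[F]_(m'.+1, n'.+1)).
Local Notation m := m'.+1.
Local Notation n := n'.+1.

Definition var_row (i : nat) : 'rV[F]_n := row (inord i) X.

Lemma Mprod_wprod i : (i <= m)%N -> Mprod X i = wprod var_row i.
Proof.
move=> im; rewrite /Mprod.
transitivity (\big[mulmx/1%:M]_(k < i) W (var_row k)).
  rewrite (big_ord_widen_cond m xpredT (fun k => W (var_row k))) //.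
  by apply: eq_big => // k _; rewrite /var_row inord_val.
elim: i {im} => [|i IH]; first by rewrite big_ord0.
have E : \prod_(k < i.+1) W (var_row k) = (\prod_(k < i) W (var_row k)) * W (var_row i).
  by rewrite big_ord_recr.
by rewrite /= -IH; exact: E.
Qed.

Lemma enum_bottom j : (0 < j)%N ->
  map val (enum [set k : 'I_n | (j <= k.+1)%N]) = iota j.-1 (n.+1 - j).
Proof.
move=> j0; rewrite {1}/enum_mem -enumT (eq_filter (a2 := preim val (fun k => j <= k.+1)%N)); last first.
  by move=> k; rewrite /= inE.
rewrite -filter_map val_enum_ord.
case: (leqP j n.+1) => jn; last first.
  have -> : (n.+1 - j = 0)%N by lia.
  apply/eqP; rewrite -[_ == _]negbK -has_filter; apply/hasPn => x; rewrite mem_iota; lia.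
have -> : iota 0 n = iota 0 j.-1 ++ iota j.-1 (n.+1 - j).
  by rewrite -iotaD; congr iota; lia.
rewrite filter_cat (_ : filter _ (iota 0 _) = [::]); last first.
  by apply/eqP; rewrite -[_ == _]negbK -has_filter; apply/hasPn => x; rewrite mem_iota; lia.
by apply/all_filterP/allP => x; rewrite mem_iota; lia.
Qed.

Lemma left_minor_corner j (A : 'M[F]_n) : (0 < j <= n.+1)%N ->
  left_minor [set k : 'I_n | (j <= k.+1)%N] A = corner_minor (n.+1 - j) A.
Proof.
move=> /andP[j0 jn]; set I := [set k | _].
have En := enum_bottom j0.
have cI : #|I| = (n.+1 - j)%N by rewrite cardE -(size_map val) En size_iota.
pose G a b := A (inord (j.-1 + a)) (inord b).
have aux x : (x < n.+1 - j)%N -> (j.-1 + x < n)%N by lia.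
have aux' x : (x < n.+1 - j)%N -> (x < n)%N by lia.
have -> : left_minor I A = \det (\matrix_(a < #|I|, b < #|I|) G a b).
  congr (\det _); apply/matrixP => a b; rewrite !mxE /G; congr (A _ _); apply/val_inj.
    have lt : (a < n.+1 - j)%N := leq_trans (ltn_ord a) (eq_leq cI).
    rewrite /= inordK; last exact: aux.
    rewrite (enum_val_nth (Ordinal (ltn0Sn n'))) -(nth_map _ 0%N) ?En ?nth_iota //.
    by rewrite -cardE; apply: ltn_ord.
  have lt : (b < n.+1 - j)%N := leq_trans (ltn_ord b) (eq_leq cI).
  by rewrite /= inordK //; apply: aux'.
rewrite cI -det_rev; congr (\det _); apply/matrixP => a b; rewrite !mxE /G.
by congr (A (inord _) _); have := ltn_ord a; lia.
Qed.

Local Notation M := (wprod var_row).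

Lemma z'E j i : (0 < j <= n)%N -> (i <= m)%N ->
  z' X j i = corner_minor (n.+1 - j) (M i) / corner_minor (n - j) (M i).
Proof.
move=> /andP[j0 jn] im; rewrite /z' Mprod_wprod // !left_minor_corner //; lia.
Qed.

Lemma corner_minor0 (A : 'M[F]_n) : corner_minor 0 A = 1 :> F.
Proof. exact: det_mx00. Qed.

(** The diagonal of this minor lies on subdiagonal [i] of the product, made of entries 1 with zeros
    below it. *)
Lemma corner_minor_band (w : nat -> 'rV[F]_n) i : (i <= n)%N ->
  corner_minor (n - i) (wprod w i) = 1.
Proof.
move=> iN; rewrite /corner_minor.
have E (a b : 'I_(n - i)) : (a <= b)%N ->
    wprod w i (inord (n' - a)) (inord ((n - i).-1 - b)) = (a == b)%:R.
  move=> ab; have := ltn_ord a; have := ltn_ord b => bn an.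
  rewrite wprod_band !inordK; try lia.
  by congr (nat_of_bool _)%:R; rewrite -val_eqE /=; lia.
rewrite det_trig; last by apply/is_trig_mxP => a b ab; rewrite mxE E 1?ltnW // -val_eqE ltn_eqF.
by rewrite big1 // => a _; rewrite mxE E // eqxx.
Qed.

Hypothesis corner_neq0 : forall i s, (i <= m)%N -> (s <= n)%N -> (n <= i + s)%N ->
  corner_minor s (M i) != 0.

Local Notation laurent := (laurent_sum (Q_pattern X)).

Lemma Q_pattern_neq0 k : Q_pattern X k != 0.
Proof.
case: k => [[j i] /= ji]; have jn := ltn_ord j; have im := ltn_ord i.
rewrite /Q_pattern /= z'E; try lia.
by apply: mulf_neq0; rewrite ?invr_eq0; apply: corner_neq0; lia.
Qed.

(** The quotient is [z'] at [j = n + 1 - s]; the bound [n < i + s] says [j <= i]. *)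
Lemma corner_step s i : (0 < s <= n)%N -> (i <= m)%N -> (n < i + s)%N ->
  laurent (corner_minor s (M i) / corner_minor s.-1 (M i)) /\
  laurent (corner_minor s (M i) / corner_minor s.-1 (M i))^-1.
Proof.
move=> /andP[s0 sn] im ins.
have jn : (n - s < n)%N by lia. have im' : (i.-1 < m)%N by lia.
have ji : (Ordinal jn <= Ordinal im')%N by rewrite /=; lia.
pose kk : Z_index m n := exist _ (Ordinal jn, Ordinal im') ji.
have <- : Q_pattern X kk = corner_minor s (M i) / corner_minor s.-1 (M i).
  rewrite /Q_pattern /= z'E; try lia.
  by congr (corner_minor _ (M _) / corner_minor _ (M _)); lia.
split; [exact: laurent_sum_var|exact: laurent_sum_varV].
Qed.

(** The minor telescopes into entries of the pattern, down to size [n - m] (0 if [m >= n]), where it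
    equals 1. *)
Lemma corner_minorV s : (s <= n)%N -> (n <= s + m)%N -> laurent (corner_minor s (M m))^-1.
Proof.
elim: s => [|s IH] sn ns; first by rewrite corner_minor0 invr1; apply: laurent_sum1.
case: (eqVneq n (s.+1 + m)%N) => E.
  have -> : s.+1 = (n - m)%N by lia.
  by rewrite corner_minor_band ?invr1; [apply: laurent_sum1|lia].
have ns' : (n <= s + m)%N by lia.
have [|//||_ H] := @corner_step s.+1 m; [lia..|].
have := laurent_sumM Q_pattern_neq0 H (IH (ltnW sn) ns'); rewrite -invfM mulfVK //.
by apply: corner_neq0; lia.
Qed.

(** For [i < n] both minors of size tied to the band are 1 and the ratio is the entry [z'] at
    [(i + 1, i + 1)]. For [i >= n] the subtraction truncates to 0 and the ratio is that of the
    entries at [(n, i + 1)] and [(n, i)]. *)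
Lemma corner_ratio_laurent i : (i < m)%N -> laurent (corner_ratio var_row i (n' - i)).
Proof.
move=> im; rewrite /corner_ratio; case: (leqP i n') => iN.
  have -> : (n' - i).+1 = (n - i)%N by lia.
  rewrite (@corner_minor_band var_row i) 1?ltnW // divr1.
  have [|//||+ _] := @corner_step (n - i) i.+1; [lia..|].
  have -> : (n - i).-1 = (n - i.+1)%N by lia.
  by rewrite corner_minor_band // divr1.
have -> : (n' - i = 0)%N by lia.
have [|//||H _] := @corner_step 1 i.+1; [lia..|].
have [|||_ H'] := @corner_step 1 i; [lia..|].
have := laurent_sumM Q_pattern_neq0 H H'.
by rewrite !corner_minor0 !divr1.
Qed.

Lemma corner_ratio_ratio_laurent i c : (i < m)%N -> (n' - i < c < n)%N ->
  laurent (corner_ratio var_row i c / corner_ratio var_row i c.-1).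
Proof.
move=> im /andP[ic cn]; rewrite /corner_ratio.
have -> : c.-1.+1 = c by lia.
have [|//||H _] := @corner_step c.+1 i.+1; [lia..|].
have [|||_ H'] := @corner_step c.+1 i; [lia..|].
have := laurent_sumM Q_pattern_neq0 H H'.
have E (x y x' y' : F) : x / y * (x' / y')^-1 = x / x' / (y / y').
  by rewrite !invf_div mulrACA [RHS]mulrACA [y^-1 * _]mulrC.
by rewrite E.
Qed.

End QPattern.

Section PseudoEnergies.
Variables (F : fieldType) (m' n' : nat) (X : 'M[F]_(m'.+1, n'.+1)).
Local Notation m := m'.+1.
Local Notation n := n'.+1.
Local Notation M := (wprod (var_row X)).
Local Notation laurent := (laurent_sum (Q_pattern X)).
Hypothesis corner_neq0 : forall i s, (i <= m)%N -> (s <= n)%N -> (n <= i + s)%N ->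
  corner_minor s (M i) != 0.

Lemma column_le_head la mu (a : 'I_(size (columns la mu))) : (column a <= head 0 la)%N.
Proof.
have : column a \in columns la mu by apply: mem_nth.
by rewrite mem_filter mem_iota => /and3P[_ _]; rewrite add1n ltnS.
Qed.

Lemma modz_eq0 (q : nat) : (q%:Z = 0 %[mod n%:Z])%Z -> (q %% n = 0)%N.
Proof. by rewrite modz_nat mod0z => -[]. Qed.

Theorem loop_schur_laurent la mu r : skew_shape la mu ->
  corner_color_condition m n la mu r -> laurent (loop_schur X la mu r).
Proof.
move=> skewP [NW SE].
(* The residue of [r], raised by a multiple of [n] that keeps all positions nonnegative. *)
pose R := (`|(r %% n%:Z)%Z|%N + n * (head 0%N la + m))%N.
have Rge : (head 0%N la + m <= R)%N by rewrite /R mulSn; lia.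
have Rr : (R%:Z = r %[mod n%:Z])%Z.
  rewrite /R PoszD PoszM gez0_abs ?modz_ge0 // addrC.
  by rewrite -modzDml modzMr add0r modz_mod.
have RC (a : 'I_(size (columns la mu))) : (column a <= R)%N.
  by have := column_le_head a; lia.
have RH (a : 'I_(size (columns la mu))) : (column a + m <= col_hi a + R)%N.
  by have := column_le_head a; lia.
have colorE (a b : nat) : (content a b + r = R%:Z + (a%:Z - b%:Z) %[mod n%:Z])%Z.
  by rewrite addrC -[LHS]modzDml -Rr modzDml.
rewrite (loop_schur_rdet X skewP RC RH Rr).
apply: rdet_evolve_pos => //.
- exact: end_pos_decr.
(* If the bottom cell of the column has a right neighbor, the next column ends in the same row and
   its particle ends at [q - 1]. Otherwise the cell is a SE corner, and color [m] means that [q] is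
   0 modulo [n]. *)
- move=> a; set q := end_pos _ _ a => q0.
  have Hhi : in_skew la mu (col_hi a) (column a).
    by rewrite (in_skewE skewP) ?(column_gt0 skewP) // leqnn andbT (lo_hi skewP).
  case: (boolP (in_skew la mu (col_hi a) (column a).+1)) => [inr|ninr].
    have [s Er Ec] := cell_exists skewP inr.
    exists (cell_index skewP s); have := column_index skewP s; rewrite Ec => Ecol.
    have Ehi : col_hi (cell_index skewP s) = col_hi a.
      apply/eqP; rewrite eqn_leq {1}/col_hi Ecol col_height_anti //=.
      by have := cell_indexP skewP s; rewrite Er => /andP[].
    by rewrite /q /end_pos Ehi Ecol; have := RH (cell_index skewP s); rewrite Ehi Ecol; lia.
  have /SE : SE_corner la mu (col_hi a) (column a).
    rewrite /SE_corner Hhi ninr andbT /= (in_skewE skewP) ?(column_gt0 skewP) //.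
    by rewrite ltnn andbF.
  rewrite colorE => /eqP; rewrite -(eqz_modDr (- m%:Z)) subrr => /eqP E.
  have : (q %% n = 0)%N; last by lia.
  apply: modz_eq0; rewrite -E /q /end_pos; congr (_ %% _)%Z.
  by have := RH a; have := RC a; lia.
- exact: laurent_sum0.
- exact: laurent_sum1.
- by move=> x y; apply: laurent_sumD.
- by move=> x y; apply: laurent_sumM; apply: Q_pattern_neq0.
- by move=> i; apply: corner_ratio_laurent.
- by move=> i c; apply: corner_ratio_ratio_laurent.
- exact/decreasingP/start_pos_decr.
(* Likewise at the top: a left neighbor gives a particle starting at [q.+1], while at a NW corner
   color [n] makes [q] the last position of its block. *)
move=> a; set q := start_pos _ a => q0.
have Hlo : in_skew la mu (col_lo a).+1 (column a).
  by rewrite (in_skewE skewP) ?(column_gt0 skewP) // leqnn /= (lo_hi skewP).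
case: (boolP (in_skew la mu (col_lo a).+1 (column a).-1)) => [inl|ninl].
  have [s Er Ec] := cell_exists skewP inl.
  exists (cell_index skewP s); have := column_index skewP s; rewrite Ec => Ecol.
  have Elo : col_lo (cell_index skewP s) = col_lo a.
    apply/eqP; rewrite eqn_leq; apply/andP; split.
      by have := cell_indexP skewP s; rewrite Er => /andP[].
    by apply: col_height_anti; rewrite Ecol leq_pred.
  rewrite /q /start_pos Elo Ecol; have := RC a; have := cell_col_gt0 s; rewrite Ec; lia.
have /NW : NW_corner la mu (col_lo a).+1 (column a).
  rewrite /NW_corner Hlo ninl andbT /= (in_skewE skewP) ?(column_gt0 skewP) //.
  by rewrite ltnn.
rewrite colorE modzz => E.
have : (q.+1 %% n = 0)%N.
  apply: modz_eq0; rewrite mod0z -E /q /start_pos; congr (_ %% _)%Z.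
  by have := RC a; lia.
by rewrite -addn1 -modnDml addn1 modn_small.
Qed.

(** With [R = n] the particles of the rectangle start at the last [s] positions of block 0 and end
    at its first [s] positions. *)
Lemma shape_invE k : (1 <= k <= minn m n)%N ->
  shape_inv X k = corner_minor (n - k + 1) (M m).
Proof.
rewrite leq_min => /and3P[k1 km kn]; rewrite /shape_inv leq_min km kn /=.
set s := (n - k + 1)%N; set l := (m - k + 1)%N.
have skewP : skew_shape (nseq l s) [::].
  split=> // [|a]; last by rewrite nth_nil.
  by apply/(sortedP 0%N) => i; rewrite size_nseq => lt; rewrite !nth_nseq lt ltnW //=.
have hE : col_height (nseq l s) =1 (fun c => if (c <= s)%N then l else 0)%N.
  by move=> c; rewrite /col_height count_nseq; case: leqP; rewrite ?mul1n ?mul0n.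
have cE : columns (nseq l s) [::] = iota 1 s.
  rewrite /columns; have -> : head 0%N (nseq l s) = s by rewrite /l addn1.
  apply/all_filterP/allP => c; rewrite mem_iota add1n ltnS => /andP[_ cs].
  by rewrite hE cs /col_height /= /l addn1.
have colE (a : 'I_(size (columns (nseq l s) [::]))) : column a = a.+1.
  have := ltn_ord a; rewrite /column {2 3}cE size_iota => lt.
  by rewrite nth_iota // add1n.
have sz : size (columns (nseq l s) [::]) = s by rewrite cE size_iota.
have as_ (a : 'I_(size (columns (nseq l s) [::]))) : (a < s)%N.
  exact: leq_trans (ltn_ord a) (eq_leq sz).
have hiE (a : 'I_(size (columns (nseq l s) [::]))) : col_hi a = l.
  by rewrite /col_hi colE hE as_.
rewrite (loop_schur_rdet X skewP (R := n)) //; first last.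
- by move=> a; rewrite hiE colE; have := as_ a; rewrite /l /s; lia.
- by move=> a; rewrite colE; have := as_ a; rewrite /s; lia.
have -> : corner_minor s (M m) = corner_minor (size (columns (nseq l s) [::])) (M m).
  by rewrite sz.
rewrite corner_minorE; last by rewrite sz /s; lia.
congr (\det _); apply/row_matrixP => a; rewrite !rowK.
have -> : start_pos n a = (n' - a)%N.
  by rewrite /start_pos colE /col_lo /col_height /= add0n subSS.
have lt : (n' - a < n)%N by lia.
rewrite -[LHS](@blockact1 _ n') -/(wprod (var_row X) 0) evolve_block0 // add0n.
apply: eq_blockact => q; apply/rowP => b; rewrite !mxE.
congr (nat_of_bool (q == _))%:R; rewrite /end_pos hiE colE.
have aux x y : y = s -> (x < s)%N -> (l + n - x.+1 - m = y.-1 - x)%N.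
  by move=> ->; rewrite /l /s; lia.
exact: aux sz (as_ b).
Qed.

Lemma shape_inv_laurentV k : (0 < k)%N -> laurent (shape_inv X k)^-1.
Proof.
move=> k0; case: (leqP k (minn m n)) => km; last first.
  by rewrite /shape_inv leqNgt km invr1; apply: laurent_sum1.
rewrite shape_invE ?k0 //; move: km; rewrite leq_min => /andP[km kn].
by apply: corner_minorV => //; lia.
Qed.

End PseudoEnergies.

(** * The shapes of the Q-invariants *)

Section QShapes.
Variables (m n i j : nat).
Hypotheses (Hi : (1 <= i <= m)%N) (Hj : (1 <= j <= n)%N) (Hij : (i + j <= m)%N).

Lemma Q_KE : (Q_K m n i j < n)%N /\
  exists t, (m + Q_K m n i j - n = i + j - 1 + n * t)%N /\ (n <= m + Q_K m n i j)%N.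
Proof.
have n0 : n%:Z != 0 by lia.
set c := (i%:Z + j%:Z - m%:Z - 1)%R.
have E : (Q_K m n i j)%:Z = (c %% n%:Z)%Z by rewrite /Q_K gez0_abs ?modz_ge0.
split; first by rewrite -ltz_nat E ltz_pmod //; lia.
have := divz_eq c n%:Z; rewrite -E; set d := (c %/ n%:Z)%Z => Ed.
have dneg : (d < 0)%R.
  rewrite ltNge; apply/negP => d0.
  have : 0 <= d * n%:Z by rewrite mulr_ge0.
  by rewrite /c in Ed *; lia.
(* Here [K = i + j - m - 1 - d * n] with [d < 0]. The [- n] in the length absorbs one multiple of
   [n], and [- d - 1] remain. *)
exists `|- d - 1|%N; case: d Ed dneg => // d Ed _.
have -> : `|- Negz d - 1|%N = d by rewrite NegzE opprK; lia.
rewrite NegzE /c mulNr in Ed.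
have Ed' : (i + j + d.+1 * n = m + 1 + Q_K m n i j)%N by lia.
by rewrite mulSn mulnC in Ed'; split; lia.
Qed.

Lemma nth_Q_la x : nth 0%N (Q_la m n i j) x =
  (if x < m + Q_K m n i j - n then n - j + Q_K m n i j + 1
   else if x - (m + Q_K m n i j - n) < m - (i + j) then n - j else 0)%N.
Proof. by rewrite nth_cat size_nseq !nth_nseq; case: ltnP. Qed.

Lemma nth_Q_mu x : nth 0%N (Q_mu m n i j) x =
  (if x < m + Q_K m n i j - n - i then n - j + 1 else 0)%N.
Proof. by rewrite nth_nseq. Qed.

Lemma Q_skew_shape : skew_shape (Q_la m n i j) (Q_mu m n i j).
Proof.
split.
- by apply/(sortedP 0%N) => x _; rewrite /= !nth_Q_la; do ?[case: ifP => ?]; lia.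
- by apply/(sortedP 0%N) => x _; rewrite /= !nth_Q_mu; do ?[case: ifP => ?]; lia.
- by move=> x; rewrite nth_Q_la nth_Q_mu; do ?[case: ifP => ?]; lia.
Qed.

(** Put [A = m + K - n]. The only candidate corners are [(1, n - j + 2)] and [(A - i + 1, 1)], of
    colors 0 and [n + n * t], then [(A, n - j + K + 1)] and [(A + m - i - j, n - j)], of colors
    [m - n] and [m + n * t]. In degenerate shapes some of them are absent. *)
Lemma Q_corner_color :
  corner_color_condition m n (Q_la m n i j) (Q_mu m n i j) (n%:Z - j%:Z + 1).
Proof.
have [Kn [t [At nK]]] := Q_KE.
set K := Q_K m n i j in Kn At nK *; set A := (m + K - n)%N in At *.
have key (x y q : int) : x = y + q * n%:Z -> (x = y %[mod n%:Z])%Z.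
  by move=> ->; rewrite addrC modzMDl.
have tn : (t%:Z * n%:Z = (n * t)%N%:Z)%R by rewrite mulrC PoszM.
move: At tn; move: (n * t)%N => nt At tn.
split=> a b; rewrite /NW_corner /SE_corner /in_skew !nth_Q_la !nth_Q_mu -/K -/A /content.
  move=> /and3P[/andP[a0 H1] H2 H3].
  have [[xA [a1 bE]]|[xA [aE bE]]] : (a.-1 < A - i /\ a = 1 /\ b = n - j + 2 \/
      A - i <= a.-1 /\ a = A - i + 1 /\ b = 1)%N.
  - move: H1 H2 H3; case: (ltnP a.-1 (A - i)) => c1.
      rewrite (leq_trans c1 (leq_subr _ _)) => H1 H2 H3.
      left; split=> //; split; last by lia.
      have [a1|a1] := posnP a.-1; first by lia.
      have c2 : (a.-1.-1 < A - i)%N by apply: leq_ltn_trans c1; apply: leq_pred.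
      by move: H2; rewrite a1 c2 (leq_trans c2 (leq_subr _ _)) H1.
    set y := (if (a.-1 < A)%N then _ else _) => H1 H2 H3.
    right; split=> //; split; last by lia.
    have [a1|a1] := posnP a.-1; first by lia.
    move: H2; rewrite a1; case: (ltnP a.-1.-1 (A - i)) => c2; first by lia.
    set y' := (if (a.-1.-1 < A)%N then _ else _).
    suff : (y <= y')%N by lia.
    by rewrite /y /y'; clear; do ?[case: ifP => ?]; lia.
  - by apply: (key _ _ (-1)); rewrite a1 bE; lia.
  by apply: (key _ _ t%:Z); rewrite tn aE bE; lia.
move=> /and3P[/andP[a0 H1] H2 H3].
have [[aE bE]|[aE bE]] : (a = A /\ b = n - j + K + 1 \/
    a = A + (m - (i + j)) /\ b = n - j)%N.
- move: H1 H2 H3; case: (ltnP a.-1 A) => c1.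
    set z := (if (a.-1 < A - i)%N then _ else _).
    rewrite [a.+1.-1]/=; case: (ltnP a A) => c2; last by move=> H1 _ H3; left; lia.
    have : ((if a < A - i then n - j + 1 else 0) <= z)%N.
      by rewrite /z; clear; do ?[case: ifP => ?]; lia.
    by set z' := (if _ then _ else _); lia.
  rewrite (ltnNge a.-1) (leq_trans (leq_subr _ _) c1) /=.
  case: (ltnP (a.-1 - A) (m - (i + j))) => c2; last by move=> /andP[b0]; rewrite leqNgt b0.
  have c3 : (A <= a)%N by apply: leq_trans c1 (leq_pred a).
  rewrite (ltnNge a) (leq_trans (leq_subr _ _) c3) (ltnNge a A) c3 /= => H1.
  case: (ltnP (a - A) (m - (i + j))) => c4 H2 H3; first by rewrite H1 in H2.
  by right; lia.
- by apply: (key _ _ (-1)); rewrite aE bE; lia.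
by apply: (key _ _ t%:Z); rewrite tn aE bE; lia.
Qed.

End QShapes.

(** * Nonvanishing of the corner minors *)

Section Genericity.

(* W is only defined over fields; this version applies to polynomial rings. *)
Fixpoint ring_wprod (A : comNzRingType) n' (w : nat -> 'rV[A]_n'.+1) (i : nat) : 'M[A]_n'.+1 :=
  if i is i'.+1
  then ring_wprod w i' *m (diag_mx (w i') + \matrix_(a, b) (a == b.+1 :> nat)%:R)
  else 1%:M.

Lemma map_ring_wprod (A B : comNzRingType) (f : {rmorphism A -> B}) n'
    (w : nat -> 'rV[A]_n'.+1) i :
  map_mx f (ring_wprod w i) = ring_wprod (fun j => map_mx f (w j)) i.
Proof.
elim: i => [|i IH] /=; first exact: map_mx1.
rewrite map_mxM IH map_mxD map_diag_mx; congr (_ *m (_ + _)).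
by apply/matrixP => a b; rewrite !mxE; apply: (rmorph_nat f).
Qed.

Lemma eq_ring_wprod (A : comNzRingType) n' (w w' : nat -> 'rV[A]_n'.+1) i :
  w =1 w' -> ring_wprod w i = ring_wprod w' i.
Proof. by move=> ww'; elim: i => //= i ->; rewrite ww'. Qed.

Lemma wprod_ring (F : fieldType) n' (w : nat -> 'rV[F]_n'.+1) i : wprod w i = ring_wprod w i.
Proof. by elim: i => //= i ->. Qed.

(** The first [e] factors are nilpotent shifts and the others are lower unitriangular. The product
    thus has entries 1 on subdiagonal [e] and zeros above it, which makes the corner minor of size
    [n - e] unitriangular. *)
Lemma corner_minor_shift (F : fieldType) n' (w : nat -> 'rV[F]_n'.+1) e s i :
  (e + s = n'.+1)%N -> (e <= i)%N ->
  (forall j, (j < i)%N -> w j = const_mx (e <= j)%N%:R) -> corner_minor s (wprod w i) = 1.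
Proof.
move=> es ei wE.
have ME l : (l <= i)%N -> forall q p : 'I_n'.+1, (q <= p + minn l e)%N ->
    wprod w l q p = (q == p + minn l e :> nat)%N%:R.
  elim: l => [|l IH] li q p qp; first by rewrite min0n addn0 mxE.
  have {}IH := IH (ltnW li).
  have WE c : W (w l) c p = (e <= l)%N%:R *+ (c == p) + (c == p.+1 :> nat)%:R.
    by rewrite W_E wE // mxE.
  rewrite mxE; case: (leqP e l) => el.
    have E1 : minn l.+1 e = e by lia. have E2 : minn l e = e by lia.
    rewrite E1 E2 in qp IH *; rewrite (bigD1 p) //= WE el eqxx ltn_eqF // addr0 mulr1 IH //.
    rewrite big1 ?addr0 // => c cp; rewrite WE (negPf cp) mulr0n add0r.
    case: eqP => Ec; rewrite ?mulr0 // IH ?Ec ?ltn_eqF ?mul0r //; lia.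
  have E1 : minn l.+1 e = l.+1 by lia. have E2 : minn l e = l by lia.
  rewrite E1 E2 in qp IH *; case: (ltnP p.+1 n'.+1) => pn.
    rewrite (bigD1 (Ordinal pn)) //= WE (leqNgt e) el mul0rn add0r eqxx mulr1 IH /=; last by lia.
    rewrite big1 ?addr0 => [|c cp]; first by congr (nat_of_bool _)%:R; lia.
    rewrite WE (leqNgt e) el mul0rn add0r; case: eqP => Ec; rewrite ?mulr0 //.
    by case/eqP: cp; apply/val_inj.
  rewrite big1 => [|c _]; last first.
    rewrite WE (leqNgt e) el mul0rn add0r ltn_eqF ?mulr0 //.
    by apply: leq_trans (ltn_ord c) pn.
  by rewrite ltn_eqF //; have := ltn_ord q; lia.
have E (a b : 'I_s) : (b <= a)%N ->
    wprod w i (inord (n' - a)) (inord (s.-1 - b)) = (a == b)%:R.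
  move=> ba; have := ltn_ord a; have := ltn_ord b => bs as_.
  rewrite ME // ?(minn_idPr ei) ?inordK; try lia.
  by congr (nat_of_bool _)%:R; rewrite -val_eqE /=; lia.
rewrite /corner_minor -det_tr det_trig; last first.
  by apply/is_trig_mxP => a b ab; rewrite !mxE E 1?ltnW // -val_eqE gtn_eqF.
by rewrite big1 // => a _; rewrite !mxE E // eqxx.
Qed.

(* Specialize the first n - s rows of variables to 0 and the others to 1. *)
Lemma generic_corner_neq0 (C : fieldType) m' n' i s : (i <= m'.+1)%N -> (s <= n'.+1)%N ->
  (n'.+1 <= i + s)%N ->
  corner_minor s (wprod (var_row (generic_matrix C m'.+1 n'.+1)) i) != 0.
Proof.
move=> im sn ins; pose e := (n'.+1 - s)%N.
pose Xp : 'M[{mpoly C[m'.+1 * n'.+1]}]_(m'.+1, n'.+1) := \matrix_(a, b) 'X_(mxvec_index a b).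
pose Y : 'M[C]_(m'.+1, n'.+1) := \matrix_(a, b) (e <= a)%N%:R.
pose v k := mxvec Y 0 k.
pose D (A : comNzRingType) (N : 'M[A]_n'.+1) :=
  \det (\matrix_(a < s, b < s) N (inord (n' - a)) (inord (s.-1 - b))).
have DE (A B : comNzRingType) (f : {rmorphism A -> B}) N : f (D A N) = D B (map_mx f N).
  by rewrite /D -det_map_mx; congr (\det _); apply/matrixP => a b; rewrite !mxE.
rewrite wprod_ring.
pose wp j := row (inord j) Xp.
have -> : ring_wprod (var_row (generic_matrix C m'.+1 n'.+1)) i
   = map_mx (@tofrac _) (ring_wprod wp i).
  rewrite map_ring_wprod; apply: eq_ring_wprod => j.
  by apply/rowP => b; rewrite !mxE.
rewrite -[corner_minor _ _]/(D _ _) -DE tofrac_eq0.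
apply/eqP => /(congr1 (meval v)); rewrite rmorph0 DE map_ring_wprod.
have -> : ring_wprod (fun j => map_mx (meval v) (wp j)) i = wprod (fun j => row (inord j) Y) i.
  rewrite wprod_ring; apply: eq_ring_wprod => j.
  by apply/rowP => b; rewrite !mxE mevalXU /v mxvecE mxE.
rewrite -[D _ _]/(corner_minor _ _) (@corner_minor_shift _ _ _ e); try by rewrite /e; lia.
  by apply/eqP; apply: oner_neq0.
move=> j ji; apply/rowP => b; rewrite !mxE inordK //.
by apply: leq_trans ji im.
Qed.

End Genericity.

Theorem lemma5p8 (R : realType) (m n : nat) (hm : (1 <= m)%N) (hn : (1 <= n)%N) :
  let X := @generic_matrix (complex R) m n in
  [/\ (forall f : ratfun (complex R) m n,
         pseudo_energy X f -> positive_laurent (Q_pattern X) f),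
      (forall i j : nat,
         (1 <= i <= m)%N -> (1 <= j <= n)%N -> (i + j <= m)%N ->
         positive_laurent (Q_pattern X) (Q_inv X i j))
    & (forall i j : nat,
         (1 <= i <= m)%N -> (1 <= j <= n)%N -> (i + j <= m)%N ->
         positive_laurent (Q_pattern X) (reduced_Q_inv X i j))].
Proof.
case: m hm => // m' _; case: n hn => // n' _ X.
have nz := @generic_corner_neq0 (complex R) m' n'.
have Qinv i j : (1 <= i <= m'.+1)%N -> (1 <= j <= n'.+1)%N -> (i + j <= m'.+1)%N ->
    laurent_sum (Q_pattern X) (Q_inv X i j).
  move=> Hi Hj Hij; apply: loop_schur_laurent => //; first exact: Q_skew_shape.
  exact: Q_corner_color.
split=> [f [la [mu [r [sk cc ->]]]]|i j Hi Hj Hij|i j Hi Hj Hij]; apply: laurent_sum_positive.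
- exact: loop_schur_laurent.
- exact: Qinv.
have QM := laurent_sumM (Q_pattern_neq0 nz).
rewrite /reduced_Q_inv invfM; apply: (QM); first exact: Qinv.
apply: (QM); apply: shape_inv_laurentV => //.
by have [] := Q_KE Hi Hj Hij; lia.
Qed.
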